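(* Let $u_0$ be an admissible initial value with $\|u_0\|\le 1$ and $|M_0|\neq|\Omega|$, where $M_0=\int_\Omega u_0(\mathbf{x})\,\mathrm{d}\mathbf{x}$, and let $\kappa\ge \max_{|\xi|\le 1}(|f'(\xi)|+|g'(\xi)|)=4$. Then for any time step size $\tau>0$, the solution $\{u^n\}_{n\ge 0}$ of the ETD1 scheme satisfies $$\int_\Omega u^{n}(\mathbf{x})\,\mathrm{d}\mathbf{x}=M_0,\qquad \forall\, n\ge 0.$$
   Context: Let $\Omega\subset\mathbb{R}^d$ ($d=2,3$) be open, connected and bounded with Lipschitz boundary, $\varepsilon>0$, and let $\|\cdot\|$ be the supremum norm on $C(\overline\Omega)$. Boundary conditions: either homogeneous Neumann ($\partial u/\partial\mathbf{n}=0$ on $\partial\Omega$), or periodic, in which case $\Omega=\prod_{i=1}^d(a_i,b_i)$ and all functions, including $u_0$, are periodic. An admissible initial value is $u_0\in C(\overline\Omega)$ (periodic in the periodic case). Put $f(s)=s-s^3$, $g(s)=1-s^2$, and for $\xi\in C(\overline\Omega)$ with $\int_\Omega g(\xi)\,\mathrm{d}\mathbf{x}\ne0$, $$\lambda_\xi=\frac{\int_\Omega f(\xi(\mathbf{x}))\,\mathrm{d}\mathbf{x}}{\int_\Omega g(\xi(\mathbf{x}))\,\mathrm{d}\mathbf{x}},\qquad \mathcal{N}[\xi]=\kappa\xi+f(\xi)-\lambda_\xi\, g(\xi).$$ Let $\mathcal{L}_\kappa=\varepsilon^2\Delta-\kappa\mathcal{I}$, where $\Delta$ is the Laplacian with the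 chosen boundary condition; $\{e^{t\Delta}\}_{t\ge0}$ is the contraction semigroup it generates with respect to the supremum norm (on $C(\overline\Omega)$, or its subspace of periodic functions in the periodic case), and $e^{t\mathcal{L}_\kappa}=e^{-\kappa t}e^{t\varepsilon^2\Delta}$. ETD1 scheme with step $\tau>0$: $u^0=u_0$, and for $n\ge 0$, $u^{n+1}=w^n(\tau)$, where $w^n$ solves $\partial_s w^n=\mathcal{L}_\kappa w^n+\mathcal{N}[u^n]$ in $\Omega$ for $s\in(0,\tau]$, $w^n(\cdot,0)=u^n$, with the chosen boundary condition; equivalently $$u^{n+1}=e^{\tau\mathcal{L}_\kappa}u^n+\int_0^\tau e^{(\tau-s)\mathcal{L}_\kappa}\mathcal{N}[u^n]\,\mathrm{d}s.$$ *)

(* Defs.v *)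
From HB Require Import structures.
From mathcomp Require Import all_boot all_order all_algebra.
From mathcomp Require Import all_classical all_reals all_analysis.
From mathcomp Require Import lra.
Set Implicit Arguments.
Unset Strict Implicit.
Unset Printing Implicit Defensive.
Import Order.TTheory GRing.Theory Num.Theory.
Import numFieldNormedType.Exports.

Local Open Scope classical_set_scope.
Local Open Scope ring_scope.

Definition rV_display : measure_display -> measure_display.
Proof. exact. Qed.

Section measurable_rV.
Variables (R : realType) (n : nat).

Let coord (i : 'I_n) (x : 'rV[R]_n) : measurableTypeR R := x ord0 i.

Let rV_set0 : g_sigma_preimage coord set0.
Proof. exact: sigma_algebra0. Qed.

Let rV_setC A : g_sigma_preimage coord A -> g_sigma_preimage coord (~` A).
Proof. exact: sigma_algebraC. Qed.

Let rV_bigcup (F : (set 'rV[R]_n)^nat) :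
  (forall i, g_sigma_preimage coord (F i)) ->
  g_sigma_preimage coord (\bigcup_i (F i)).
Proof. exact: sigma_algebra_bigcup. Qed.

(* The sigma-algebra generated by the coordinates, as the library does for
   n.-tuple; on R^n it is the Borel sigma-algebra. *)
HB.instance Definition _ := @isMeasurable.Build
  (rV_display default_measure_display)
  'rV[R]_n (g_sigma_preimage coord) rV_set0 rV_setC rV_bigcup.

Lemma measurable_rV_coord (i : 'I_n) :
  measurable_fun [set: 'rV[R]_n] (coord i).
Proof.
move=> _ Y mY; rewrite setTI; apply: sub_sigma_algebra => /=.
rewrite -bigcup_seq/=; exists i => /=; first by rewrite mem_index_enum.
by exists Y => //; rewrite setTI.
Qed.

Lemma measurable_fun_rVP d (T : measurableType d) (f : T -> 'rV[R]_n) :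
  (forall i, measurable_fun [set: T] (fun x => coord i (f x))) ->
  measurable_fun [set: T] f.
Proof.
move=> mf.
suff : g_sigma_preimage (fun i => coord i \o f) `<=` measurable.
  rewrite g_sigma_preimage_comp => prefS _ A mA.
  by apply: prefS; exists A.
apply: smallest_sub; first exact: sigma_algebra_measurable.
rewrite -bigcup_seq; apply: bigcup_sub => i _ _ [B mB <-].
exact: mf.
Qed.

End measurable_rV.

Section lebesgue_rV.
Variable R : realType.

Definition rV_cons n (p : measurableTypeR R * 'rV[R]_n) : 'rV[R]_n.+1 :=
  \row_i if unlift ord0 i is Some j then p.2 ord0 j else p.1.

Definition rV_uncons n (x : 'rV[R]_n.+1) : measurableTypeR R * 'rV[R]_n :=
  (x ord0 ord0, \row_i x ord0 (lift ord0 i)).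

Lemma rV_consE n p (i : 'I_n.+1) : @rV_cons n p ord0 i =
  if unlift ord0 i is Some j then p.2 ord0 j else p.1.
Proof.
by rewrite mxE.
Qed.

Lemma rV_consK n : cancel (@rV_cons n) (@rV_uncons n).
Proof.
move=> [x v]; rewrite /rV_uncons; congr pair.
  by rewrite rV_consE unlift_none.
by apply/rowP => i; rewrite mxE rV_consE liftK.
Qed.

Lemma measurable_rV_cons n : measurable_fun [set: _] (@rV_cons n).
Proof.
apply: measurable_fun_rVP => i.
under eq_fun do rewrite rV_consE.
case: unlift => [j|]; last exact: measurable_fst.
exact: (measurableT_comp (@measurable_rV_coord R n j) measurable_snd).
Qed.

Lemma measurable_rV_uncons n : measurable_fun [set: _] (@rV_uncons n).
Proof.
apply: measurable_fun_pair; first exact: (@measurable_rV_coord R n.+1 ord0).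
apply: measurable_fun_rVP => i; under eq_fun do rewrite mxE.
exact: (@measurable_rV_coord R n.+1 (lift ord0 i)).
Qed.

Section step.
Variables (n : nat) (mu : {sigma_finite_measure set 'rV[R]_n -> \bar R}).

Let prodm : {measure set _ -> \bar R} := (lebesgue_measure \x mu)%E.

Definition lebesgue_rV_step : set 'rV[R]_n.+1 -> \bar R :=
  pushforward (lebesgue_measure \x mu)%E (@rV_cons n).

Let step_ge0 A : (0 <= lebesgue_rV_step A)%E.
Proof. exact: (measure_ge0 prodm). Qed.

Let step0 : lebesgue_rV_step set0 = 0%E.
Proof. by rewrite /lebesgue_rV_step /pushforward preimage_set0 (measure0 prodm). Qed.

Let mpreim A : measurable A -> measurable (@rV_cons n @^-1` A).
Proof.
by move=> mA; rewrite -[X in measurable X]setTI; exact: measurable_rV_cons.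
Qed.

Let step_sigma_additive : semi_sigma_additive lebesgue_rV_step.
Proof.
move=> F mF tF mUF; rewrite /lebesgue_rV_step /pushforward preimage_bigcup.
apply: (@measure_semi_sigma_additive _ _ _ prodm).
- by move=> k; exact: mpreim.
- apply/trivIsetP => /= i j _ _ ij; rewrite -preimage_setI.
  by move/trivIsetP : tF => /(_ _ _ _ _ ij) ->//; rewrite preimage_set0.
- by rewrite -preimage_bigcup; exact: mpreim.
Qed.

HB.instance Definition _ := isMeasure.Build _ _ _ lebesgue_rV_step
  step0 step_ge0 step_sigma_additive.

Let step_sigma_finite : sigma_finite setT lebesgue_rV_step.
Proof.
have /sigma_finiteP[F [TF ndF Foo]] := sigma_finiteT (@lebesgue_measure R).
have /sigma_finiteP[G [TG ndG Goo]] := sigma_finiteT mu.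
exists (fun k => @rV_uncons n @^-1` (F k `*` G k)).
  rewrite -preimage_bigcup; apply/esym; rewrite -subTset => x _ /=.
  have [i _ Fi] : (\bigcup_i F i) (rV_uncons x).1 by rewrite -TF.
  have [j _ Gj] : (\bigcup_i G i) (rV_uncons x).2 by rewrite -TG.
  exists (maxn i j) => //; split.
    by move: Fi; apply/subsetPset/ndF/leq_maxl.
  by move: Gj; apply/subsetPset/ndG/leq_maxr.
move=> k; have [? ?] := Foo k; have [? ?] := Goo k; split.
  rewrite -[X in measurable X]setTI; apply: measurable_rV_uncons => //.
  exact: measurableX.
rewrite /lebesgue_rV_step /pushforward -comp_preimage.
rewrite (_ : @rV_uncons n \o @rV_cons n = id); last first.
  by apply/funext => p; exact: rV_consK.
by rewrite preimage_id product_measure1E// lte_mul_pinfty// ge0_fin_numE.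
Qed.

HB.instance Definition _ := Measure_isSigmaFinite.Build _ _ _ lebesgue_rV_step
  step_sigma_finite.

End step.

(* d-fold product of the Lebesgue measure on the line. *)
Fixpoint lebesgue_rV n : {sigma_finite_measure set 'rV[R]_n -> \bar R} :=
  match n with
  | 0 => dirac (0 : 'rV[R]_0)
  | n'.+1 => lebesgue_rV_step (lebesgue_rV n')
  end.

Definition open_box n (a b : 'rV[R]_n) : set 'rV[R]_n :=
  [set x | forall i, a ord0 i < x ord0 i < b ord0 i].

Lemma measurable_open_box n (a b : 'rV[R]_n) : measurable (open_box a b).
Proof.
rewrite (_ : open_box a b = \bigcap_(i in [set: 'I_n])
    ((fun x : 'rV[R]_n => x ord0 i) @^-1` `]a ord0 i, b ord0 i[%classic)).
  apply: fin_bigcap_measurable => // i _.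
  rewrite -[X in measurable X]setTI.
  by apply: (@measurable_rV_coord R n i) => //; exact: measurable_itv.
apply/seteqP; split => x /= h i; first by move=> _; rewrite /= in_itv/=; exact: h.
by have := h i I; rewrite /= in_itv.
Qed.

Lemma lebesgue_rV_box n (a b : 'rV[R]_n) : (forall i, a ord0 i <= b ord0 i) ->
  lebesgue_rV n (open_box a b) = (\prod_i (b ord0 i - a ord0 i))%:E.
Proof.
elim: n => [|n IH] in a b * => ab.
  by rewrite big_ord0 /= diracE mem_set//= => -[].
pose a' := (rV_uncons a).2; pose b' := (rV_uncons b).2.
rewrite [LHS](_ : _ = (lebesgue_measure \x lebesgue_rV n)%E
    (`]a ord0 ord0, b ord0 ord0[%classic `*` open_box a' b')); last first.
  congr product_measure1; apply/seteqP; split => -[x v] /=.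
    move=> h; split => /=.
      by have := h ord0; rewrite rV_consE unlift_none /= in_itv.
    by move=> i; have := h (lift ord0 i); rewrite rV_consE liftK !mxE.
  move=> [/= xab h] i; rewrite rV_consE; case: unliftP => [j|] ->.
    by have := h j; rewrite !mxE.
  by move: xab; rewrite in_itv.
rewrite product_measure1E//; last exact: measurable_open_box.
rewrite IH => [|i]; last by rewrite !mxE.
rewrite big_ord_recl EFinM; congr (_ * _)%E.
  rewrite [LHS](lebesgue_measure_itv `]a ord0 ord0, b ord0 ord0[) /= lte_fin.
  case: ltgtP (ab ord0) => // -> _; by rewrite subrr.
by congr (_%:E); apply: eq_bigr => i _; rewrite !mxE.
Qed.

End lebesgue_rV.

Section domain.
Variables (R : realType) (d : nat).
Implicit Types (Omega : set 'rV[R]_d) (u v : 'rV[R]_d -> R).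

(* Near each boundary point, and in suitable orthonormal coordinates [x *m Q],
   Omega is the strict epigraph, in the direction of the i-th coordinate, of a
   Lipschitz function of the remaining ones. *)
Definition lipschitz_boundary Omega :=
  forall p, (closure Omega `\` interior Omega) p ->
    exists r : R, 0 < r /\
    exists (Q : 'M[R]_d) (i : 'I_d) (gamma : 'rV[R]_d.-1 -> R),
      [/\ Q *m Q^T = 1%:M, lipschitz gamma &
        forall x, ball p r x ->
          Omega x <-> gamma (col' i (x *m Q)) < (x *m Q) ord0 i].

Definition lipschitz_domain Omega :=
  [/\ open Omega, connected Omega, bounded_set Omega &
      lipschitz_boundary Omega].

Inductive boundary_condition :=
| Neumann
| Periodic of 'rV[R]_d & 'rV[R]_d.

Definition bc_domain (bc : boundary_condition) Omega :=
  match bc with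
  | Neumann => True
  | Periodic a b =>
      (forall i, a ord0 i < b ord0 i) /\ Omega = open_box a b
  end.

Definition periodic_on (a b : 'rV[R]_d) (A : set 'rV[R]_d) u :=
  forall x y, A x -> A y ->
    (forall i, exists k : int,
       y ord0 i - x ord0 i = k%:~R * (b ord0 i - a ord0 i)) ->
    u x = u y.

(* C(closure Omega), or its subspace of periodic functions.  Its elements are
   represented by functions on the whole of R^d, whose values off the closure
   of Omega are never used. *)
Definition bc_space (bc : boundary_condition) Omega u :=
  {within closure Omega, continuous u} /\
  match bc with
  | Neumann => True
  | Periodic a b => periodic_on a b (closure Omega) u
  end.

Definition supnorm Omega u : R := sup [set `|u x| | x in closure Omega].

Definition integral_over Omega u : R := \int[lebesgue_rV R d]_(x in Omega) u x.

Definition volume Omega : R := fine (lebesgue_rV R d Omega).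

Definition partial (i : 'I_d) u : 'rV[R]_d -> R :=
  fun x => 'D_(delta_mx ord0 i : 'rV[R]_d) u x.

Definition smooth u :=
  forall s : seq 'I_d,
    continuous (foldr partial u s) /\
    forall i x, derivable (foldr partial u s) x (delta_mx ord0 i : 'rV[R]_d).

(* C_c^oo(Omega), respectively the smooth periodic functions on R^d. *)
Definition test_function (bc : boundary_condition) Omega u :=
  smooth u /\
  match bc with
  | Neumann => exists K, [/\ compact K, K `<=` Omega &
                            forall x, ~ K x -> u x = 0]
  | Periodic a b => periodic_on a b [set: 'rV[R]_d] u
  end.

Definition square_integrable Omega u :=
  measurable_fun Omega u /\
  (lebesgue_rV R d).-integrable Omega (fun x => (u x ^+ 2)%:E).

(* u is in H^1(Omega), respectively H^1_per(Omega), with weak gradient G.  In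
   the periodic case the test functions do not vanish on the boundary of the
   cell, so that this is H^1 of the torus. *)
Definition weak_gradient (bc : boundary_condition) Omega u
    (G : 'I_d -> 'rV[R]_d -> R) :=
  [/\ square_integrable Omega u,
      forall i, square_integrable Omega (G i) &
      forall phi i, test_function bc Omega phi ->
        integral_over Omega (fun x => u x * partial i phi x) =
        - integral_over Omega (fun x => G i x * phi x)].

(* [laplacian bc Omega u v] : u is in the domain of the Laplacian, seen as an
   operator in [bc_space bc Omega], and v is its image.  On a Lipschitz domain
   the Neumann condition is the natural boundary condition of the variational
   formulation, with all of H^1 as test space. *)
Definition laplacian (bc : boundary_condition) Omega u v :=
  [/\ bc_space bc Omega u, bc_space bc Omega v &
    exists2 G, weak_gradient bc Omega u G &
      forall phi H, weak_gradient bc Omega phi H ->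
        integral_over Omega (fun x => \sum_i G i x * H i x) =
        - integral_over Omega (fun x => v x * phi x)].

Record contraction_semigroup (bc : boundary_condition) Omega
    (S : R -> ('rV[R]_d -> R) -> 'rV[R]_d -> R) : Prop := {
  semigroup_space : forall t u, 0 <= t ->
    bc_space bc Omega u -> bc_space bc Omega (S t u);
  semigroup_linear : forall t a u v, 0 <= t ->
    bc_space bc Omega u -> bc_space bc Omega v ->
    {in closure Omega,
      S t (fun x => a * u x + v x) =1 (fun x => a * S t u x + S t v x)};
  semigroup0 : forall u, bc_space bc Omega u -> {in closure Omega, S 0 u =1 u};
  semigroupD : forall s t u, 0 <= s -> 0 <= t -> bc_space bc Omega u ->
    {in closure Omega, S (s + t) u =1 S s (S t u)};
  semigroup_contraction : forall t u, 0 <= t -> bc_space bc Omega u ->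
    supnorm Omega (S t u) <= supnorm Omega u;
  semigroup_continuous : forall u, bc_space bc Omega u ->
    supnorm Omega (fun x => S t u x - u x) @[t --> 0^'+] --> 0
}.

Definition generator (bc : boundary_condition) Omega
    (S : R -> ('rV[R]_d -> R) -> 'rV[R]_d -> R) u v :=
  [/\ bc_space bc Omega u, bc_space bc Omega v &
    supnorm Omega (fun x => t^-1 * (S t u x - u x) - v x)
      @[t --> 0^'+] --> 0].

(* S is the family of operators e^{t Delta}, t >= 0. *)
Definition laplacian_semigroup (bc : boundary_condition) Omega
    (S : R -> ('rV[R]_d -> R) -> 'rV[R]_d -> R) :=
  contraction_semigroup bc Omega S /\
  forall u v, generator bc Omega S u v <-> laplacian bc Omega u v.

Definition freact (s : R) : R := s - s ^+ 3.
Definition gmob (s : R) : R := 1 - s ^+ 2.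

(* Meaningful only if the denominator is nonzero; otherwise it is 0, since
   division is total. *)
Definition lambda Omega u : R :=
  integral_over Omega (freact \o u) / integral_over Omega (gmob \o u).

Definition nonlin (kappa : R) Omega u : 'rV[R]_d -> R :=
  fun x => kappa * u x + freact (u x) - lambda Omega u * gmob (u x).

(* e^{t L_kappa} = e^{- kappa t} e^{t eps^2 Delta} *)
Definition exp_L (eps kappa : R)
    (S : R -> ('rV[R]_d -> R) -> 'rV[R]_d -> R) (t : R) u : 'rV[R]_d -> R :=
  fun x => expR (- kappa * t) * S (t * eps ^+ 2) u x.

(* The integral over [0, tau] of functions with values in C(closure Omega) is
   evaluated pointwise. *)
Definition etd1_step (eps kappa tau : R) Omega
    (S : R -> ('rV[R]_d -> R) -> 'rV[R]_d -> R) u : 'rV[R]_d -> R :=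
  fun x => exp_L eps kappa S tau u x +
    \int[lebesgue_measure]_(s in `[0, tau])
      exp_L eps kappa S (tau - s) (nonlin kappa Omega u) x.

Definition etd1_solution (bc : boundary_condition) (eps kappa tau : R) Omega
    (S : R -> ('rV[R]_d -> R) -> 'rV[R]_d -> R) u0
    (u : nat -> 'rV[R]_d -> R) :=
  [/\ forall n, bc_space bc Omega (u n),
      {in closure Omega, u 0%N =1 u0} &
      forall n, {in closure Omega,
        u n.+1 =1 etd1_step eps kappa tau Omega S (u n)}].

End domain.

Arguments Neumann {R d}.

Definition kappa_min (R : realType) : R :=
  sup [set `|derive1 (@freact R) xi| + `|derive1 (@gmob R) xi| |
       xi in [set xi : R | `|xi| <= 1]].

Lemma kappa_minE (R : realType) : kappa_min R = 4.
Proof.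
have df (x : R) : derive1 (@freact R) x = 1 - 3 * x ^+ 2.
  rewrite derive1E /freact; apply: derive_val; apply: is_derive_eq.
  rewrite -mulr_natl /GRing.scale/=; lra.
have dg (x : R) : derive1 (@gmob R) x = - 2 * x.
  rewrite derive1E /gmob; apply: derive_val; apply: is_derive_eq.
  rewrite /GRing.scale/=; lra.
rewrite /kappa_min; set A := (X in sup X).
have A4 : A 4.
  exists 1 => /=; first by rewrite normr1.
  rewrite df dg expr1n !mulr1 ler0_norm; last by lra.
  by rewrite ler0_norm; lra.
have ubA : ubound A 4.
  move=> _ [x /= x1 <-]; rewrite df dg.
  have : `|x| ^+ 2 <= 1 by rewrite expr_le1.
  have : `|- 2 * x| <= 2 by rewrite normrM normrN normr_nat; lra.
  have : `|1 - 3 * x ^+ 2| <= 2 -> `|- 2 * x| <= 2 ->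
    `|1 - 3 * x ^+ 2| + `|- 2 * x| <= 4 by lra.
  move=> h h2; rewrite -normrX ger0_norm ?sqr_ge0// => h3.
  apply: h => //; rewrite ler_norml; have := sqr_ge0 x; lra.
apply/le_anti/andP; split; first by apply: ge_sup => //; exists 4.
by apply: ub_le_sup => //; exists 4.
Qed.

(* Main.v *)
Require Import Defs.
From HB Require Import structures.
From mathcomp Require Import all_boot all_order all_algebra.
From mathcomp Require Import all_classical all_reals all_analysis.
From mathcomp Require Import measurable_realfun.
From mathcomp Require Import ring lra.
Set Implicit Arguments.
Unset Strict Implicit.
Unset Printing Implicit Defensive.
Import Order.TTheory GRing.Theory Num.Theory.
Import numFieldNormedType.Exports.

Local Open Scope classical_set_scope.
Local Open Scope ring_scope.

(** Two facts carry the proof: the heat semigroup preserves the integral over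
    Omega, and the nonlinear term satisfies int N[u] = kappa int u as soon as
    int g(u) != 0, because lambda is chosen to cancel int f(u).  Integrating
    the formula for one step of the scheme therefore gives
      int u^{n+1} = exp(- kappa tau) M_0
                  + int_0^tau kappa exp(- kappa (tau - s)) M_0 ds = M_0.

    Conservation by the semigroup S ([semigroup_mass]).  For continuous u,
    V = int_0^t S(s) u ds lies in the domain of the generator, with image
    S(t) u - u ([generator_curve_int]), so no density argument is needed.  The
    generator is the weak Laplacian, and the constant 1 is an admissible test
    function with weak gradient 0; testing against it yields
    int (S(t) u - u) = 0 ([integral_laplacian]).  That the constant 1 has weak
    gradient 0 means that partial derivatives of test functions integrate to
    0; both kinds of test functions take equal values on opposite faces of a
    box, and slicing the box reduces this to the fundamental theorem of
    calculus on a line ([integral_partial_eq0]).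

    Integrals of curves of continuous functions are taken pointwise.  A curve
    that is uniformly continuous for the supremum norm is integrated by
    Riemann sums that converge uniformly in space; hence the integral is again
    continuous in space and commutes with every bounded linear functional
    ([functional_curve_int]).  This is used with evaluation of S(h) at a point
    and with integration over Omega.

    It remains to see that int g(u^n) != 0.  The bound |u^n| <= 1 propagates
    ([etd1_step_bound]): S is a contraction, |lambda| <= 1 because f(s) = s g(s)
    with g >= 0 on [-1, 1], and |N[u]| <= kappa when kappa >= 4.  If the
    integral of the nonnegative function g(u^n) vanished, then u^n would take
    only the values 1 and -1, hence be constant on the connected set Omega, and
    |M_0| would equal |Omega| ([integral_gmob_neq0]). *)

(** * Lebesgue measure and topology on row vectors *)

Section measure_rV.
Variables (R : realType) (n : nat).
Implicit Types (U : set 'rV[R]_n) (a b x : 'rV[R]_n).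

Lemma open_box_subset_nbhs x U : nbhs x U ->
  exists a b : 'rV[rat]_n,
    open_box (map_mx ratr a) (map_mx ratr b) x /\
    open_box (map_mx ratr a) (map_mx ratr b) `<=` (U : set 'rV[R]_n).
Proof.
move=> /nbhs_ballP[e /= e0 eU].
have ha (i : 'I_n) : exists q : rat, x ord0 i - e < ratr q < x ord0 i.
  have [q qi] : exists q : rat, ratr q \in `](x ord0 i - e), (x ord0 i)[.
    by apply: rat_in_itvoo; rewrite ltrBlDr ltrDl.
  by exists q; move: qi; rewrite in_itv.
have hb (i : 'I_n) : exists q : rat, x ord0 i < ratr q < x ord0 i + e.
  have [q qi] : exists q : rat, ratr q \in `](x ord0 i), (x ord0 i + e)[.
    by apply: rat_in_itvoo; rewrite ltrDl.
  by exists q; move: qi; rewrite in_itv.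
have [a aP] := choice ha; have [b bP] := choice hb.
exists (\row_i a i), (\row_i b i); split => [i|y xy].
  by rewrite !mxE; have /andP[_ ->] := aP i; have /andP[-> _] := bP i.
apply: eU; split => // i j; rewrite (ord1 i).
have := xy j; rewrite !mxE /ball/= ltr_distl => /andP[h1 h2].
have /andP[h3 _] := aP j; have /andP[_ h4] := bP j.
by apply/andP; split; lra.
Qed.

(** The sigma-algebra on row vectors is generated by the coordinates, so
    topology enters it only through the countable base of boxes with rational
    vertices. *)
Lemma open_measurable_rV U : open U -> measurable U.
Proof.
move=> oU.
pose box (p : 'rV[rat]_n * 'rV[rat]_n) : set 'rV[R]_n :=
  open_box (map_mx ratr p.1) (map_mx ratr p.2).
(* Pairs of rational vectors are enumerated through their code k. *)
pose F (k : nat) := if unpickle k is Some p then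
  if `[< box p `<=` U >] then box p else set0 else set0.
rewrite (_ : U = \bigcup_k F k).
  apply: bigcupT_measurable => k; rewrite /F.
  case: unpickle => [p|]; last exact: measurable0.
  by case: asboolP => _; [exact: measurable_open_box|exact: measurable0].
apply/seteqP; split => [x Ux|x [k _]].
  have [a [b [abx abU]]] : exists a b : 'rV[rat]_n, box (a, b) x /\
      box (a, b) `<=` U.
    by apply: open_box_subset_nbhs; exact: oU.
  exists (pickle (a, b)) => //; rewrite /F pickleK.
  by case: asboolP.
by rewrite /F; case: unpickle => // p; case: asboolP => // h /h.
Qed.

Lemma continuous_measurable_rV U (f : 'rV[R]_n -> R) : open U ->
  {within U, continuous f} -> measurable_fun U f.
Proof.
move=> oU; rewrite continuous_open_subspace// => cf.
apply: (measurability _ (RGenOpens.measurableE R)).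
move=> _ [_ [a [b ->] <-]]; apply: open_measurable_rV.
rewrite openE => x [Ux fx]; apply: filterI; first exact: oU.
have /cf : x \in U by rewrite inE.
by apply; apply: open_nbhs_nbhs; split => //; exact: interval_open.
Qed.

Lemma open_box_open a b : open (open_box a b).
Proof.
rewrite openE => x abx.
apply: (@filter_forall _ _ (fun i (y : 'rV[R]_n) =>
  is_true (a ord0 i < y ord0 i < b ord0 i)) (nbhs x) _) => i.
have /(@coord_continuous _ _ _ ord0 i x) h :
    nbhs (x ord0 i) `]a ord0 i, b ord0 i[%classic.
  apply: open_nbhs_nbhs; split; first exact: interval_open.
  by rewrite /= in_itv; exact: abx.
exact: (@filterS _ _ (nbhs_filter x)
  (fun y : 'rV[R]_n => `]a ord0 i, b ord0 i[%classic (y ord0 i)) _ _ h).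
Qed.

Lemma bounded_open_box (U : set 'rV[R]_n) : bounded_set U ->
  exists2 M : R, 0 < M & U `<=` open_box (\row__ - M) (\row__ M).
Proof.
move=> [M [Mr hM]]; have M0 : 0 < `|M| + 1 by rewrite ltr_wpDl.
exists (`|M| + 2) => [|x Ux i]; first by rewrite ltr_wpDl.
rewrite !mxE -ltr_norml; apply: (@le_lt_trans _ _ `|x|).
  by rewrite [leRHS]/Num.norm /= mx_normrE; apply/bigmax_geP; right => /=;
    exists (ord0, i).
apply: (@le_lt_trans _ _ (`|M| + 1)); last by rewrite ltrD2l ltr1n.
by apply: hM => //; rewrite (le_lt_trans (ler_norm _))// ltrDl.
Qed.

Lemma bounded_lebesgue_rV_lty U : open U -> bounded_set U ->
  (lebesgue_rV R n U < +oo)%E.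
Proof.
move=> oU /bounded_open_box[M M0 UM].
apply: (@le_lt_trans _ _ (lebesgue_rV R n (open_box (\row__ - M) (\row__ M)))).
  apply: le_measure => //; rewrite inE; last exact: measurable_open_box.
  exact: open_measurable_rV.
by rewrite lebesgue_rV_box ?ltry// => i; rewrite !mxE; lra.
Qed.

Lemma lebesgue_rV_open_gt0 U : open U -> U !=set0 ->
  (0 < lebesgue_rV R n U)%E.
Proof.
move=> oU [x Ux]; have /open_box_subset_nbhs[a [b [abx abU]]] := oU _ Ux.
apply: (@lt_le_trans _ _
    (lebesgue_rV R n (open_box (map_mx ratr a) (map_mx ratr b)))).
  rewrite lebesgue_rV_box => [|i].
    rewrite lte_fin; apply: prodr_gt0 => i _; rewrite subr_gt0.
    by have /andP[/lt_trans h1 /h1] := abx i.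
  by have /andP[/lt_trans h1 /h1/ltW] := abx i.
apply: le_measure => //; rewrite inE; last exact: open_measurable_rV.
exact: measurable_open_box.
Qed.

End measure_rV.

(** * Partial derivatives integrate to zero over boxes *)

Section integrable_rV.
Variables (R : realType) (n : nat).
Implicit Types (U : set 'rV[R]_n) (a b x : 'rV[R]_n).

(** Boxes with closed sides are compact, and a bounded set lies in one. *)
Lemma compact_closure_bounded U : bounded_set U -> compact (closure U).
Proof.
move=> /bounded_open_box[M M0 UM].
have cB : compact [set x : 'rV[R]_n | forall i, `[- M, M]%classic (x ord0 i)].
  by apply: (@rV_compact _ _ (fun=> `[- M, M]%classic)) => _; exact: segment_compact.
apply: (subclosed_compact _ cB); first exact: closed_closure.
have hB : closed [set x : 'rV[R]_n | forall i, `[- M, M]%classic (x ord0 i)].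
  by apply: compact_closed => //; exact: norm_hausdorff.
rewrite closureE; apply: smallest_sub => // x /UM h i.
by have := h i; rewrite !mxE /= in_itv/= => /andP[/ltW -> /ltW ->].
Qed.

Lemma within_closure_bounded U (f : 'rV[R]_n -> R) : bounded_set U ->
  {within closure U, continuous f} ->
  exists2 M : R, 0 <= M & forall x, closure U x -> `|f x| <= M.
Proof.
move=> /compact_closure_bounded cU cf.
have /compact_bounded[M [_ hM]] := continuous_compact cf cU.
exists (`|M| + 1) => [|x Ux]; first by rewrite addr_ge0.
apply: hM; first by rewrite (le_lt_trans (ler_norm _))// ltrDl.
by exists x.
Qed.

Lemma within_closure_integrable U (f : 'rV[R]_n -> R) :
  open U -> bounded_set U -> {within closure U, continuous f} ->
  (lebesgue_rV R n).-integrable U (EFin \o f).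
Proof.
move=> oU bU cf; apply: measurable_bounded_integrable.
- exact: open_measurable_rV.
- exact: bounded_lebesgue_rV_lty.
- apply: continuous_measurable_rV => //.
  by apply: continuous_subspaceW cf; exact: subset_closure.
- have [M M0 fM] := within_closure_bounded bU cf.
  exists M; split; rewrite ?num_real // => N MN x Ux /=.
  by rewrite (le_trans (fM _ (subset_closure Ux)))// ltW.
Qed.

Lemma open_box_bounded a b : bounded_set (open_box a b).
Proof.
exists (`|a| + `|b|); split; rewrite ?num_real// => M abM x abx.
rewrite /= {1}/Num.norm /= mx_normrE; apply/bigmax_leP => /=; split => [|[k i] _ /=].
  by rewrite (le_trans _ (ltW abM))// addr_ge0.
have coord (v : 'rV[R]_n) : `|v ord0 i| <= `|v|.
  by rewrite [leRHS]/Num.norm /= mx_normrE; apply/bigmax_geP; right => /=;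
    exists (ord0, i).
rewrite (ord1 k) (le_trans _ (ltW abM))// ler_norml.
have := abx i; have := coord a; have := coord b.
rewrite !ler_norml => /andP[? ?] /andP[? ?] /andP[? ?].
by have := normr_ge0 a; have := normr_ge0 b; lra.
Qed.

End integrable_rV.

Section box_slices.
Variables (R : realType) (n : nat) (a b : 'rV[R]_n.+1).
Let a' := (rV_uncons a).2.
Let b' := (rV_uncons b).2.

(** The measure on row vectors of size n.+1 is the image under [rV_cons] of a
    product with a line; this is the domain of integration that Fubini sees. *)
Lemma preimage_cons_open_box : @rV_cons R n @^-1` open_box a b =
  `]a ord0 ord0, b ord0 ord0[%classic `*` open_box a' b'.
Proof.
apply/seteqP; split => -[x v] /=.
  move=> h; split => /=.
    by have := h ord0; rewrite rV_consE unlift_none /= in_itv.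
  by move=> i; have := h (lift ord0 i); rewrite rV_consE liftK !mxE.
move=> [/= xab h] i; rewrite rV_consE; case: unliftP => [j|] ->.
  by have := h j; rewrite !mxE.
by move: xab; rewrite in_itv.
Qed.

Variable f : 'rV[R]_n.+1 -> R.
Hypothesis cf : continuous f.

Let g : measurableTypeR R * 'rV[R]_n -> \bar R :=
  (EFin \o f \o @rV_cons R n)
    \_ (`]a ord0 ord0, b ord0 ord0[%classic `*` open_box a' b').

Let intf : (lebesgue_rV R n.+1).-integrable (open_box a b) (EFin \o f).
Proof.
apply: within_closure_integrable.
- exact: open_box_open.
- exact: open_box_bounded.
- exact: continuous_subspaceT.
Qed.

Let mf : measurable_fun setT f.
Proof.
by apply: continuous_measurable_rV; [exact: openT|exact: continuous_subspaceT].
Qed.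

Let mX : measurable
  ((`]a ord0 ord0, b ord0 ord0[%classic : set (measurableTypeR R)) `*`
   open_box a' b').
Proof.
by apply: measurableX; [exact: measurable_itv|exact: measurable_open_box].
Qed.

Let integral_step :
  (\int[lebesgue_rV R n.+1]_(x in open_box a b) (f x)%:E =
   \int[lebesgue_measure \x lebesgue_rV R n]_z g z)%E
  /\ (lebesgue_measure \x lebesgue_rV R n)%E.-integrable setT g.
Proof.
have ig : (lebesgue_measure \x lebesgue_rV R n)%E.-integrable
    (@rV_cons R n @^-1` open_box a b) (EFin \o f \o @rV_cons R n).
  have /integrableP[_ foo] := intf.
  apply/integrableP; split.
    apply/measurable_EFinP; apply: measurable_funTS.
    by apply: measurableT_comp => //; exact: measurable_rV_cons.
  apply: le_lt_trans foo.
  rewrite -(@ge0_integral_pushforward _ _ _ _ R _ (@measurable_rV_cons R n)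
    (lebesgue_measure \x lebesgue_rV R n)%E _ (fun x => `|(f x)%:E|%E))//.
    exact: measurable_open_box.
  by apply: measurable_funTS; apply: measurableT_comp => //; exact/measurable_EFinP.
split; last first.
  by rewrite -(integrable_mkcond _ mX) -preimage_cons_open_box.
rewrite /g -integral_mkcond -preimage_cons_open_box.
rewrite -(@integral_pushforward _ _ _ _ R _ (@measurable_rV_cons R n)
    (lebesgue_measure \x lebesgue_rV R n)%E _ (EFin \o f))//.
exact/measurable_EFinP.
exact: measurable_open_box.
Qed.

(** The two ways of slicing a box: along the first coordinate, or by
    hyperplanes on which the first coordinate is fixed. *)
Lemma integral_open_box_slice_head :
  (forall v, \int[lebesgue_measure]_(x in `](a ord0 ord0), (b ord0 ord0)[)
     (f (rV_cons (x, v)))%:E = 0)%E ->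
  (\int[lebesgue_rV R n.+1]_(x in open_box a b) (f x)%:E = 0)%E.
Proof.
move=> f0; have [-> ig] := integral_step.
rewrite -integral21_prod_meas1// integral0_eq// => v _; rewrite /fubini_G /g.
have [vab|vab] := pselect (open_box a' b' v).
  rewrite -[RHS](f0 v) [RHS]integral_mkcond; apply: eq_integral => x _.
  rewrite !patchE; congr (if _ then _ else _).
  by apply/idP/idP; rewrite !inE /=; [case|split].
rewrite integral0_eq// => x _; rewrite patchE; case: ifPn => //.
by rewrite inE/= => -[].
Qed.

Lemma integral_open_box_slice_tail :
  (forall x, \int[lebesgue_rV R n]_(v in open_box a' b')
     (f (rV_cons (x, v)))%:E = 0)%E ->
  (\int[lebesgue_rV R n.+1]_(x in open_box a b) (f x)%:E = 0)%E.
Proof.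
move=> f0; have [-> ig] := integral_step.
rewrite -integral12_prod_meas1// integral0_eq// => x _; rewrite /fubini_F /g.
have [xab|xab] := pselect (`]a ord0 ord0, b ord0 ord0[%classic x).
  rewrite -[RHS](f0 x) [RHS]integral_mkcond; apply: eq_integral => v _.
  rewrite !patchE; congr (if _ then _ else _).
  by apply/idP/idP; rewrite !inE /=; [case|split].
rewrite integral0_eq// => v _; rewrite patchE; case: ifPn => //.
by rewrite inE/= => -[].
Qed.

End box_slices.

Section integral_partial.
Variable R : realType.

Lemma rV_consDdelta_head n (h x : R) (v : 'rV[R]_n) :
  rV_cons (h *: (1 : R) + x, v) =
  h *: (delta_mx ord0 ord0 : 'rV[R]_n.+1) + rV_cons (x, v).
Proof.
apply/rowP => i; rewrite rV_consE 2!mxE rV_consE mxE eqxx/=.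
by case: unliftP => [j|] ->; rewrite /= ?mulr0 ?add0r// /GRing.scale/= mulr1.
Qed.

Lemma rV_consDdelta_tail n (h x : R) (v : 'rV[R]_n) (i : 'I_n) :
  rV_cons (x, h *: (delta_mx ord0 i : 'rV[R]_n) + v) =
  h *: (delta_mx ord0 (lift ord0 i) : 'rV[R]_n.+1) + rV_cons (x, v).
Proof.
apply/rowP => k; rewrite rV_consE 2!mxE rV_consE mxE eqxx/=.
case: unliftP => [j|] -> /=; last by rewrite mulr0 add0r.
by rewrite !mxE eqxx /= (inj_eq lift_inj).
Qed.

Lemma continuous_rV_cons_head n (v : 'rV[R]_n) :
  continuous (fun x : R => rV_cons (x, v)).
Proof.
move=> x U /nbhs_ballP[e /= e0 eU]; apply/nbhs_ballP; exists e => // y xy.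
apply: eU; split => // k i; rewrite (ord1 k) !rV_consE.
by case: unlift => [j|] //=; exact: ballxx.
Qed.

Lemma continuous_rV_cons_tail n (x : R) :
  continuous (fun v : 'rV[R]_n => rV_cons (x, v)).
Proof.
move=> v U /nbhs_ballP[e /= e0 eU]; apply/nbhs_ballP; exists e => // w [_ vw].
apply: eU; split => // k i; rewrite (ord1 k) !rV_consE.
by case: unlift => [j|] //=; exact: ballxx.
Qed.

(** By induction on the dimension.  For the first coordinate, each slice is a
    line segment on which the fundamental theorem of calculus gives a
    difference of values on opposite faces.  Any other coordinate is also a
    coordinate of the hyperplane slices, where the induction hypothesis
    applies; this avoids permuting the factors of the product measure. *)
Lemma integral_partial_eq0 n (a b : 'rV[R]_n) (i : 'I_n)
    (phi : 'rV[R]_n -> R) :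
  a ord0 i < b ord0 i ->
  (forall x, derivable phi x (delta_mx ord0 i : 'rV[R]_n)) ->
  continuous phi -> continuous (partial i phi) ->
  (forall x y : 'rV[R]_n, x ord0 i = a ord0 i -> y ord0 i = b ord0 i ->
    (forall j, j != i -> x ord0 j = y ord0 j) -> phi x = phi y) ->
  (\int[lebesgue_rV R n]_(x in open_box a b) (partial i phi x)%:E = 0)%E.
Proof.
elim: n a b i phi => [|n IH] a b i phi; first by case: i.
move=> ab dphi cphi cdphi per.
case: (unliftP ord0 i) => [j|] ij; last first.
  subst i; apply: integral_open_box_slice_head => // v.
  pose p (x : R) : R := phi (rV_cons (x, v)).
  have dp (x : R) : is_derive x (1 : R) p (partial ord0 phi (rV_cons (x, v))).
    have dq : (fun h : R => h^-1 *: (p (h *: (1 : R) + x) - p x)) =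
        (fun h : R => h^-1 *: (phi (h *: (delta_mx ord0 ord0 : 'rV[R]_n.+1) +
            rV_cons (x, v)) - phi (rV_cons (x, v)))).
      by apply/funext => h; rewrite /p rV_consDdelta_head.
    apply: DeriveDef; first by rewrite /derivable dq; exact: dphi.
    by rewrite /derive dq.
  have cp : continuous p.
    move=> x; apply: continuous_comp; last exact: cphi.
    exact: continuous_rV_cons_head.
  pose q (x : R) : R := partial ord0 phi (rV_cons (x, v)).
  have cq : continuous q.
    move=> x; apply: continuous_comp; last exact: cdphi.
    exact: continuous_rV_cons_head.
  have mq : measurable_fun setT q by exact: continuous_measurable_fun.
  rewrite integral_itv_obnd_cbnd; last first.
    by apply/measurable_EFinP; apply: (@measurable_funTS _ _ _ _ _ q).
  rewrite integral_itv_bndo_bndc; last first.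
    by apply/measurable_EFinP; apply: (@measurable_funTS _ _ _ _ _ q).
  rewrite (@continuous_FTC2 _ _ p)//.
  - rewrite -EFinB; congr EFin; apply/eqP; rewrite subr_eq0; apply/eqP/esym.
    apply: per => [||k]; rewrite !rV_consE ?unlift_none//=.
    by case: unliftP => [l|] ->; rewrite ?eqxx.
  - exact: continuous_subspaceT.
  - split=> [x _||]; first by have [] := dp x.
      by apply: cvg_at_right_filter; exact: cp.
    by apply: cvg_at_left_filter; exact: cp.
  - by move=> x _; rewrite derive1E; apply: derive_val.
subst i; apply: integral_open_box_slice_tail => // x.
pose p (v : 'rV[R]_n) : R := phi (rV_cons (x, v)).
have dq v : (fun h : R => h^-1 *: (p (h *: (delta_mx ord0 j : 'rV[R]_n) + v) - p v)) =
    (fun h : R => h^-1 *: (phi (h *: (delta_mx ord0 (lift ord0 j) : 'rV[R]_n.+1) +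
      rV_cons (x, v)) - phi (rV_cons (x, v)))).
  by apply/funext => h; rewrite /p rV_consDdelta_tail.
have pp v : partial (lift ord0 j) phi (rV_cons (x, v)) = partial j p v.
  by rewrite /partial /derive dq.
under eq_integral do rewrite pp.
apply: IH.
- by rewrite !mxE.
- by move=> v; rewrite /derivable dq; exact: dphi.
- move=> v; apply: continuous_comp; last exact: cphi.
  exact: continuous_rV_cons_tail.
- rewrite (_ : partial j p = partial (lift ord0 j) phi \o (fun v => rV_cons (x, v))).
    move=> v; apply: continuous_comp; last exact: cdphi.
    exact: continuous_rV_cons_tail.
  by apply/funext => v; rewrite -pp.
- move=> v w; rewrite !mxE => vj wj vw; apply: per; rewrite ?rV_consE ?liftK//.
  move=> k; rewrite !rV_consE; case: unliftP => [l|] -> //=.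
  by rewrite (inj_eq lift_inj) => /vw.
Qed.

End integral_partial.

(** * Primitives and Riemann sums on the line *)

Section primitive.
Variable R : realType.
Implicit Types (f P : R -> R) (a b s t T e : R).

(** Uniform continuity on [0, T].  The explicit modulus is what passes from a
    curve of functions to its values at all points simultaneously. *)
Definition ucont T f := forall e, 0 < e -> exists2 d, 0 < d &
  forall s t, 0 <= s <= T -> 0 <= t <= T -> `|s - t| < d -> `|f s - f t| <= e.

Lemma ucont_within T f : ucont T f -> {within `[0, T], continuous f}.
Proof.
move=> uf; apply/subspace_continuousP => x /=; rewrite in_itv/= => xT.
apply/cvgrPdist_le => e e0; have [d d0 fd] := uf _ e0.
rewrite near_withinE; apply/nbhs_ballP; exists d => // y xy.
by rewrite /= in_itv/= => yT; exact: fd.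
Qed.

Lemma Rintegral_primitive f P a b : a <= b ->
  {within `[a, b], continuous f} ->
  (forall x, a <= x <= b -> is_derive x 1 P (f x)) ->
  \int[lebesgue_measure]_(x in `[a, b]) f x = P b - P a.
Proof.
rewrite le_eqVlt => /predU1P[<- _ _|ab cf dP].
  by rewrite set_itv1 Rintegral_set1 subrr.
have cP x : a <= x <= b -> {for x, continuous P}.
  move=> /dP xP; apply: differentiable_continuous.
  by apply/derivable1_diffP; have [] := xP.
rewrite /Rintegral (@continuous_FTC2 _ _ P)//.
- split=> [x|| ].
  + rewrite in_itv/= => /andP[ax xb].
    by have [] : is_derive x 1 P (f x) by apply: dP; rewrite !ltW.
  + by apply/cvg_at_right_filter/cP; rewrite lexx ltW.
  + by apply/cvg_at_left_filter/cP; rewrite lexx ltW.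
- move=> x; rewrite in_itv/= => /andP[ax xb].
  rewrite derive1E; apply: derive_val; apply: dP; by rewrite !ltW.
Qed.

(** A two-sided primitive, including at the endpoints: f is extended to the
    line by its values at 0 and T. *)
Lemma ucont_primitive T f : 0 <= T -> ucont T f ->
  exists P, forall x, 0 <= x <= T -> is_derive x 1 P (f x).
Proof.
move=> T0 uf; pose c x := Num.min (Num.max x 0) T.
have c0T x : 0 <= c x <= T by rewrite /c le_min ge_min lexx orbT T0 le_max lexx orbT.
have cE x : 0 <= x <= T -> c x = x.
  by move=> /andP[x0 xT]; rewrite /c max_l// min_l.
have cc x y : `|c x - c y| <= `|x - y|.
  have := ler_norm (x - y); have := ler_norm (y - x); rewrite (distrC y x).
  rewrite /c ler_norml; case: (leP x 0); case: (leP y 0); rewrite ?(min_l T0);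
  case: (leP x T); case: (leP y T); lra.
pose g x := f (c x).
have cg : continuous g.
  move=> x; apply/cvgrPdist_le => e e0; have [d d0 fd] := uf _ e0.
  apply/nbhs_ballP; exists d => // y xy; apply: fd => //.
  exact: le_lt_trans (cc _ _) xy.
(* With base point -1, the derivative at 0 is two-sided. *)
exists (fun x => \int[lebesgue_measure]_(s in `[-1, x]) g s) => x x0T.
have xT : x < T + 1 by lra.
have [||dP PE] := @continuous_FTC1_closed R g (-1) x (T + 1) xT _ _ (cg x).
- apply: continuous_compact_integrable; first exact: segment_compact.
  exact: continuous_subspaceT.
- by lra.
by apply: DeriveDef => //; rewrite -derive1E PE /g cE.
Qed.

(** The mean value theorem, applied to a primitive on each subinterval, turns
    the integral into a sum of values of f at intermediate points. *)
Lemma riemann_sum T f e (N : nat) : 0 <= T -> (0 < N)%N -> ucont T f ->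
  (forall s t, 0 <= s <= T -> 0 <= t <= T -> `|s - t| <= T / N%:R ->
    `|f s - f t| <= e) ->
  `|\int[lebesgue_measure]_(s in `[0, T]) f s -
    \sum_(j < N) T / N%:R * f (j%:R * (T / N%:R))| <= T * e.
Proof.
move=> T0 N0 uf fe; have [P dP] := ucont_primitive T0 uf.
rewrite (Rintegral_primitive T0 (ucont_within uf) dP).
set h := T / N%:R; have h0 : 0 <= h by rewrite divr_ge0.
have NR : (N%:R : R) != 0 by rewrite pnatr_eq0 -lt0n.
have Nh : N%:R * h = T by rewrite /h mulrC divfK.
have jT (j : nat) : (j <= N)%N -> 0 <= j%:R * h <= T.
  move=> jN; rewrite mulr_ge0//= -Nh ler_wpM2r//; by rewrite ler_nat.
have -> : P T - P 0 = \sum_(j < N) (P (j.+1%:R * h) - P (j%:R * h)).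
  rewrite -(big_mkord xpredT (fun j => P (j.+1%:R * h) - P (j%:R * h))).
  by rewrite (telescope_sumr (fun j => P (j%:R * h)))// mul0r Nh.
rewrite -sumrB; apply: (le_trans (ler_norm_sum _ _ _)).
apply: (@le_trans _ _ (\sum_(j < N) h * e)); last first.
  by rewrite sumr_const card_ord -[_ *+ N]mulr_natl mulrA Nh.
apply: ler_sum => j _.
have hj : j%:R * h <= j.+1%:R * h by rewrite ler_wpM2r// ler_nat.
have /andP[j0 _] := jT _ (ltnW (ltn_ord j)).
have /andP[_ jT1] := jT _ (ltn_ord j).
have [||c] := @MVT_segment _ P f _ _ hj.
- move=> x; rewrite in_itv/= => /andP[? ?]; apply: dP; lra.
- apply: derivable_within_continuous => x; rewrite in_itv/= => /andP[? ?].
  by have [] : is_derive x 1 P (f x) by apply: dP; lra.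
rewrite in_itv/= => /andP[cj cj1] ->.
have hE : j.+1%:R * h - j%:R * h = h by rewrite -mulrBl -natrB// subSnn mul1r.
rewrite hE mulrC -mulrBr normrM ger0_norm// ler_wpM2l//.
by apply: fe; rewrite -/h ?ler_norml; lra.
Qed.

End primitive.

(** * Integrals of curves of functions *)

Section curve_integral.
Variables (R : realType) (X : Type) (A : set X).
Implicit Types (F : R -> X -> R) (V : set (X -> R)) (L : (X -> R) -> R).

(** A curve s |-> F s of functions, uniformly continuous on [0, T] for the
    supremum norm on A. *)
Definition ucurve (T : R) F := forall e, 0 < e -> exists2 d, 0 < d &
  forall s t, 0 <= s <= T -> 0 <= t <= T -> `|s - t| < d ->
    forall x, A x -> `|F s x - F t x| <= e.

Definition curve_int (T : R) F : X -> R :=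
  fun x => \int[lebesgue_measure]_(s in `[0, T]) F s x.

Definition curve_sum (T : R) F (N : nat) : X -> R :=
  fun x => \sum_(j < N) T / N%:R * F (j%:R * (T / N%:R)) x.

Lemma ucurve_ucont (T : R) F x : A x -> ucurve T F -> ucont T (F ^~ x).
Proof.
move=> Ax uF e /uF[d d0 Fd]; exists d => // s t sT tT st; exact: Fd.
Qed.

(** The number of subintervals depends only on e, not on the point x: this
    uniformity is what makes Riemann sums compatible with continuity in x and
    with bounded functionals. *)
Lemma ucurve_sum_approx (T : R) F e : 0 <= T -> ucurve T F -> 0 < e ->
  exists2 N, (0 < N)%N & (forall s t, 0 <= s <= T -> 0 <= t <= T ->
      `|s - t| <= T / N%:R -> forall x, A x -> `|F s x - F t x| <= e) /\
    forall x, A x -> `|curve_int T F x - curve_sum T F N x| <= T * e.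
Proof.
move=> T0 uF e0; have [d d0 Fd] := uF _ e0.
pose N := (Num.truncn (T / d)).+1.
have NFe s t : 0 <= s <= T -> 0 <= t <= T -> `|s - t| <= T / N%:R ->
    forall x, A x -> `|F s x - F t x| <= e.
  move=> sT tT st; apply: Fd => //; apply: le_lt_trans st _.
  rewrite ltr_pdivrMr ?ltr0n// mulrC -ltr_pdivrMr//.
  exact: truncnS_gt.
exists N => //; split => // x Ax; apply: riemann_sum => //.
  exact: ucurve_ucont.
by move=> s t sT tT st; exact: NFe.
Qed.

Definition lin_closed V := V (fun=> 0) /\
  forall a u v, V u -> V v -> V (fun x => a * u x + v x).

Lemma lin_closed_sum V N (a : 'I_N -> R) (G : 'I_N -> X -> R) :
  lin_closed V -> (forall j, V (G j)) ->
  V (fun x => \sum_(j < N) a j * G j x).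
Proof.
move=> [V0 VD]; elim: N a G => [|N IH] a G VG.
  by rewrite (_ : (fun x => _) = fun=> 0)//; apply/funext => x; rewrite big_ord0.
rewrite (_ : (fun x => _) = fun x => a ord0 * G ord0 x +
    \sum_(j < N) a (lift ord0 j) * G (lift ord0 j) x); last first.
  by apply/funext => x; rewrite big_ord_recl.
by apply: VD => //; apply: (IH (a \o lift ord0) (G \o lift ord0)) => j /=.
Qed.

Lemma linear_sum V L N (a : 'I_N -> R) (G : 'I_N -> X -> R) :
  lin_closed V ->
  (forall a u v, V u -> V v -> L (fun x => a * u x + v x) = a * L u + L v) ->
  (forall j, V (G j)) ->
  L (fun x => \sum_(j < N) a j * G j x) = \sum_(j < N) a j * L (G j).
Proof.
move=> [V0 VD] linL; elim: N a G => [|N IH] a G VG.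
  rewrite big_ord0 (_ : (fun x => _) = fun=> 0); last first.
    by apply/funext => x; rewrite big_ord0.
  rewrite -[RHS](addNr (L (fun=> 0))) -mulN1r -linL//; congr L.
  by apply/funext => x; rewrite mulr0 addr0.
rewrite big_ord_recl (_ : (fun x => _) = fun x => a ord0 * G ord0 x +
    \sum_(j < N) a (lift ord0 j) * G (lift ord0 j) x); last first.
  by apply/funext => x; rewrite big_ord_recl.
rewrite linL//; last first.
  apply: (@lin_closed_sum V N (a \o lift ord0) (G \o lift ord0)) => //.
  by move=> j; exact: VG.
congr (_ + _); apply: (IH (a \o lift ord0) (G \o lift ord0)) => j.
exact: VG.
Qed.

(** Both sides are within a multiple of any e > 0 of L applied to a common
    Riemann sum.  The domain V of L is a set of functions, and boundedness is
    expressed through pointwise bounds on A, so that L may be evaluation at a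
    point after applying an operator defined only on V. *)
Lemma functional_curve_int V L C (T : R) F :
  0 <= T -> 0 <= C -> lin_closed V ->
  (forall a u v, V u -> V v -> L (fun x => a * u x + v x) = a * L u + L v) ->
  (forall u M, V u -> 0 <= M -> (forall x, A x -> `|u x| <= M) ->
    `|L u| <= C * M) ->
  ucurve T F -> (forall s, 0 <= s <= T -> V (F s)) -> V (curve_int T F) ->
  L (curve_int T F) = \int[lebesgue_measure]_(s in `[0, T]) L (F s).
Proof.
move=> T0 C0 cV linL bL uF VF VI.
have cV' := cV; case: cV' => V0 VD.
have LB u v M : V u -> V v -> 0 <= M ->
    (forall x, A x -> `|u x - v x| <= M) -> `|L u - L v| <= C * M.
  move=> Vu Vv M0 uvM.
  have -> : L u - L v = L (fun x => -1 * v x + u x) by rewrite linL//; lra.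
  apply: bL => // [|x Ax]; first exact: VD.
  by rewrite mulN1r addrC; exact: uvM.
have uLF : ucont T (fun s => L (F s)).
  move=> e e0; have e1 : 0 < e / (C + 1) by rewrite divr_gt0// ltr_wpDl.
  have [d d0 Fd] := uF _ e1; exists d => // s t sT tT st.
  apply: (@le_trans _ _ (C * (e / (C + 1)))).
    by apply: LB; [exact: VF|exact: VF|exact: ltW|exact: Fd].
  by rewrite mulrA ler_pdivrMr ?ltr_wpDl// mulrC ler_wpM2l ?lerDl// ltW.
apply/eqP; rewrite -subr_eq0 -normr_le0; apply/ler_addgt0Pl => e e0.
(* The error is at most 2 T C e1; the summand 1 keeps the divisor nonzero. *)
rewrite addr0; have K0 : 0 < 2 * (T * C) + 1 by rewrite ltr_wpDl// !mulr_ge0.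
pose e1 := e / (2 * (T * C) + 1); have e10 : 0 < e1 by rewrite divr_gt0.
have [N N0 [NF NI]] := ucurve_sum_approx T0 uF e10.
have hT (j : 'I_N) : 0 <= j%:R * (T / N%:R) <= T.
  rewrite !mulr_ge0 ?invr_ge0//= mulrCA ler_piMr// ler_pdivrMr ?ltr0n// mul1r.
  by rewrite ler_nat ltnW.
have VS : V (curve_sum T F N).
  by apply: lin_closed_sum => // j; apply: VF; exact: hT.
have h1 : `|L (curve_int T F) - L (curve_sum T F N)| <= C * (T * e1).
  by apply: LB => //; rewrite mulr_ge0// ltW.
have h2 : `|\int[lebesgue_measure]_(s in `[0, T]) L (F s) -
    L (curve_sum T F N)| <= T * (C * e1).
  rewrite /curve_sum (linear_sum _ _ linL)//; last first.
    by move=> j; apply: VF; exact: hT.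
  apply: riemann_sum => // s t sT tT st.
  by apply: LB; [exact: VF|exact: VF|exact: ltW|exact: NF].
apply: (@le_trans _ _ (C * (T * e1) + T * (C * e1))).
  apply: le_trans (lerD h1 h2); rewrite [in leRHS](distrC (\int[_]_(s in _) _)).
  exact: ler_distD.
have -> : C * (T * e1) + T * (C * e1) = 2 * (T * C) * e1 by ring.
by rewrite /e1 (mulrA (2 * (T * C)) e) ler_pdivrMr// mulrC ler_wpM2l ?lerDl// ltW.
Qed.

End curve_integral.

(** * The space of continuous functions with boundary conditions *)

Section bc_space_theory.
Variables (R : realType) (d : nat) (Omega : set 'rV[R]_d)
  (bc : boundary_condition R d).
Hypotheses (oO : open Omega) (bO : bounded_set Omega).
Implicit Types u v : 'rV[R]_d -> R.

Lemma bc_space_comp (h : R -> R) u : continuous h -> bc_space bc Omega u ->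
  bc_space bc Omega (h \o u).
Proof.
move=> ch [cu pu]; split.
  move=> x; apply: (@continuous_comp (subspace (closure Omega)) R R u h).
    exact: cu.
  exact: ch.
case: bc pu => // a b pu x y Ox Oy xy /=; congr h; exact: pu.
Qed.

Lemma bc_space_lin_closed : lin_closed (bc_space bc Omega).
Proof.
split=> [|a u v [cu pu] [cv pv]]; split.
- by apply: continuous_subspaceT => x; exact: (@cst_continuous _ R^o).
- by case: bc.
- have cau : {within closure Omega, continuous ( *%R a \o u)}.
    move=> x; apply: (@continuous_comp (subspace (closure Omega)) R R u).
      exact: cu.
    exact: mulrl_continuous.
  by move=> x; apply: (@within_continuousD _ _ _ _ ( *%R a \o u) v).
- case: bc pu pv => // p q pu pv x y Ox Oy xy.
  by rewrite (pu x y)// (pv x y).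
Qed.

Lemma supnorm_ge u x : bc_space bc Omega u -> closure Omega x ->
  `|u x| <= supnorm Omega u.
Proof.
move=> [cu _] Ox; have [M M0 uM] := within_closure_bounded bO cu.
apply: ub_le_sup; last by exists x.
by exists M => _ [y Oy <-]; exact: uM.
Qed.

Lemma norm_supnorm_le u (M : R) : 0 <= M ->
  (forall x, closure Omega x -> `|u x| <= M) -> `|supnorm Omega u| <= M.
Proof.
move=> M0 uM; have [clO0|/set0P[z Oz]] := eqVneq (closure Omega) set0.
  by rewrite /supnorm clO0 image_set0 sup0 normr0.
have ub : ubound [set `|u x| | x in closure Omega] M.
  by move=> _ [y Oy <-]; exact: uM.
rewrite ger0_norm.
  by apply: ge_sup => //; exists `|u z|; exists z.
apply: (le_trans (normr_ge0 (u z))).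
by apply: ub_le_sup; [exists M|exists z].
Qed.

Lemma bc_space_integrable u : bc_space bc Omega u ->
  (lebesgue_rV R d).-integrable Omega (EFin \o u).
Proof. by move=> [cu _]; exact: within_closure_integrable. Qed.

Lemma integral_over_linear a u v :
  bc_space bc Omega u -> bc_space bc Omega v ->
  integral_over Omega (fun x => a * u x + v x) =
  a * integral_over Omega u + integral_over Omega v.
Proof.
move=> bu bv; have mO := open_measurable_rV oO.
rewrite /integral_over RintegralD//; last 2 first.
- rewrite (_ : EFin \o _ = (fun x => a%:E * (EFin \o u) x)%E).
    by apply: integrableZl => //; exact: bc_space_integrable.
  by apply/funext => x.
- exact: bc_space_integrable.
by rewrite RintegralZl//; exact: bc_space_integrable.
Qed.

Lemma eq_integral_over u v : {in closure Omega, u =1 v} ->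
  integral_over Omega u = integral_over Omega v.
Proof.
move=> uv; apply: eq_Rintegral => x; rewrite inE => Ox.
by apply: uv; rewrite inE; exact: subset_closure.
Qed.

(** Together with [integral_over_linear], makes integration over Omega a
    functional to which [functional_curve_int] applies. *)
Lemma integral_over_bound u M : bc_space bc Omega u -> 0 <= M ->
  (forall x, closure Omega x -> `|u x| <= M) ->
  `|integral_over Omega u| <= volume Omega * M.
Proof.
move=> bu M0 uM; have mO := open_measurable_rV oO.
have iu := bc_space_integrable bu.
rewrite (le_trans (le_normr_Rintegral mO iu))//.
rewrite mulrC /volume -Rintegral_cst//; apply: le_Rintegral => //.
- exact: integrable_norm.
- apply: measurable_bounded_integrable => //.
  + exact: bounded_lebesgue_rV_lty.
  + by exists M; split; rewrite ?num_real // => N MN x _ /=;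
      rewrite ger0_norm// ltW.
- by move=> x Ox; apply: uM; exact: subset_closure.
Qed.

(** A uniform limit of Riemann sums, each of which is continuous on the
    closure of Omega. *)
Lemma bc_space_curve_int (T : R) F : 0 <= T -> ucurve (closure Omega) T F ->
  (forall s, 0 <= s <= T -> bc_space bc Omega (F s)) ->
  bc_space bc Omega (curve_int T F).
Proof.
move=> T0 uF bF; split; last first.
  case: bc bF => // a b bF x y Ox Oy xy; apply: eq_Rintegral => s.
  by rewrite inE/= in_itv/= => /bF[_]; apply.
apply/subspace_continuousP => x Ox; apply/cvgrPdist_le => e e0.
have e1 : 0 < e / (3 * (T + 1)) by rewrite divr_gt0// mulr_gt0// ltr_wpDl.
have [N N0 [_ FN]] := ucurve_sum_approx T0 uF e1.
have [cS _] : bc_space bc Omega (curve_sum T F N).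
  apply: lin_closed_sum; first exact: bc_space_lin_closed.
  move=> j; apply: bF.
  rewrite !mulr_ge0 ?invr_ge0//= mulrCA ler_piMr// ler_pdivrMr ?ltr0n// mul1r.
  by rewrite ler_nat ltnW.
have e3 : 0 < e / 3 by rewrite divr_gt0.
have Te : T * (e / (3 * (T + 1))) <= e / 3.
  by rewrite mulrA ler_pdivrMr ?mulr_gt0 ?ltr_wpDl//; lra.
move/subspace_continuousP : cS => /(_ x Ox)/cvgrPdist_le/(_ _ e3).
rewrite !near_withinE; apply: filterS => y /= h Oy.
have := FN _ Ox; have := FN _ Oy; have := h Oy.
move: Te; rewrite !ler_norml; set r := T * _ => rT.
by rewrite /from_subspace => /andP[? ?] /andP[? ?] /andP[? ?]; lra.
Qed.

End bc_space_theory.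

(** * Constants as test functions, and orbits of the semigroup *)

Section constants.
Variables (R : realType) (d : nat) (Omega : set 'rV[R]_d)
  (bc : boundary_condition R d).
Hypotheses (oO : open Omega) (bO : bounded_set Omega)
  (hbc : bc_domain bc Omega).

(** A compactly supported test function is extended by 0 to a large box and
    vanishes on its faces; a periodic one takes equal values on opposite faces
    of the cell. *)
Lemma integral_partial_test_function phi (i : 'I_d) :
  test_function bc Omega phi -> integral_over Omega (partial i phi) = 0.
Proof.
move=> [sphi]; have [cphi dphi] := sphi [::].
have [cdphi _] := sphi [:: i].
rewrite /integral_over /Rintegral.
case: bc hbc => [_ [K [cK KO phi0]]|a b [ab ->] per].
  have dphi0 x : ~ K x -> partial i phi x = 0.
    move=> Kx; rewrite /partial (@near_eq_derive _ _ _ _ (cst 0))//.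
      by rewrite derive_cst.
    have : open (~` K).
      by rewrite openC; apply: compact_closed => //; exact: norm_hausdorff.
    by rewrite openE => /(_ _ Kx); apply: filterS => y /phi0.
  have [M M0 OM] := bounded_open_box bO.
  set B := open_box _ _ in OM.
  have -> : (\int[lebesgue_rV R d]_(x in Omega) (partial i phi x)%:E =
      \int[lebesgue_rV R d]_(x in B) (partial i phi x)%:E)%E.
    rewrite integral_mkcond [RHS]integral_mkcond; congr integral.
    apply/funext => x; rewrite !patchE.
    have [Kx|Kx] := pselect (K x); last by rewrite dphi0 ?if_same.
    by rewrite !mem_set//; [exact/OM/KO|exact: KO].
  rewrite integral_partial_eq0//.
  - by rewrite !mxE; lra.
  - have out (z : 'rV[R]_d) j : z ord0 j = - M \/ z ord0 j = M -> phi z = 0.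
      move=> zj; apply: phi0 => /KO/OM/(_ j); rewrite !mxE.
      by case: zj => ->; rewrite ltxx ?andbF.
    move=> x y; rewrite !mxE => xi yi _.
    by rewrite (out x i) ?(out y i)//; [right|left].
rewrite integral_partial_eq0//.
move=> x y xi yi xy; apply: per => // j; have [->|ji] := eqVneq j i.
  by exists 1; rewrite mul1r xi yi.
by exists 0; rewrite mul0r xy// subrr.
Qed.

Lemma weak_gradient_cst : weak_gradient bc Omega (fun=> 1) (fun _ _ => 0).
Proof.
have mO := open_measurable_rV oO.
have fO := bounded_lebesgue_rV_lty oO bO.
have sq (c : R) : square_integrable Omega (fun=> c).
  split=> //; apply: measurable_bounded_integrable => //.
  by exists (`|c ^+ 2|); split; rewrite ?num_real// => N cN x _ /=; rewrite ltW.
split=> [||phi i tphi]; [exact: sq|by move=> i; exact: sq|].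
transitivity (integral_over Omega (partial i phi)).
  by congr Rintegral; apply/funext => x; rewrite mul1r.
rewrite integral_partial_test_function// /integral_over.
under eq_Rintegral do rewrite mul0r.
by rewrite Rintegral_cst// mul0r oppr0.
Qed.

(** Test the weak formulation against the constant 1.  For Neumann conditions
    this is possible because the test space is all of H^1. *)
Lemma integral_laplacian u v : laplacian bc Omega u v ->
  integral_over Omega v = 0.
Proof.
move=> [_ _ [G _ /(_ _ _ weak_gradient_cst)]].
rewrite (_ : (fun x => \sum_i G i x * 0) = fun=> 0); last first.
  by apply/funext => x; rewrite big1// => i _; rewrite mulr0.
rewrite (_ : (fun x => v x * 1) = v); last first.
  by apply/funext => x; rewrite mulr1.
rewrite {1}/integral_over Rintegral_cst ?mul0r; last exact: open_measurable_rV.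
by move=> /eqP; rewrite eq_sym oppr_eq0 => /eqP.
Qed.

End constants.

Section semigroup.
Variables (R : realType) (d : nat) (Omega : set 'rV[R]_d)
  (bc : boundary_condition R d) (S : R -> ('rV[R]_d -> R) -> 'rV[R]_d -> R).
Hypotheses (oO : open Omega) (bO : bounded_set Omega)
  (hS : contraction_semigroup bc Omega S).
Implicit Types u v : 'rV[R]_d -> R.

Lemma semigroup_bound t u M : 0 <= t -> bc_space bc Omega u -> 0 <= M ->
  (forall x, closure Omega x -> `|u x| <= M) ->
  forall x, closure Omega x -> `|S t u x| <= M.
Proof.
move=> t0 bu M0 uM x Ox.
apply: (le_trans (supnorm_ge bO (semigroup_space hS t0 bu) Ox)).
apply: (le_trans (semigroup_contraction hS t0 bu)).
by apply: (le_trans (ler_norm _)); exact: norm_supnorm_le.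
Qed.

Lemma semigroup_lin t a u v x : 0 <= t ->
  bc_space bc Omega u -> bc_space bc Omega v -> closure Omega x ->
  S t (fun y => a * u y + v y) x = a * S t u x + S t v x.
Proof. by move=> t0 bu bv Ox; rewrite (semigroup_linear hS)// inE. Qed.

Lemma semigroup_dist t u v M : 0 <= t -> bc_space bc Omega u ->
  bc_space bc Omega v -> 0 <= M ->
  (forall x, closure Omega x -> `|u x - v x| <= M) ->
  forall x, closure Omega x -> `|S t u x - S t v x| <= M.
Proof.
move=> t0 bu bv M0 uvM x Ox.
have [_ cl] := bc_space_lin_closed Omega bc.
have -> : S t u x - S t v x = S t (fun y => -1 * v y + u y) x.
  by rewrite semigroup_lin//; lra.
apply: semigroup_bound => // [|y Oy]; first exact: cl.
by rewrite mulN1r addrC; exact: uvM.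
Qed.

(** Strong continuity at 0 spreads to all times with the same modulus, since
    S(t) u - S(s) u = S(s) (S(t - s) u - u) and S(s) is a contraction.  The
    factor c is a change of time scale. *)
Lemma orbit_ucurve (T c : R) u : 0 <= c -> bc_space bc Omega u ->
  ucurve (closure Omega) T (fun s => S (s * c) u).
Proof.
move=> c0 bu e e0; have [_ cl] := bc_space_lin_closed Omega bc.
have bS s : 0 <= s -> bc_space bc Omega (S s u) by move=> ?; exact: semigroup_space.
have [r r0 Sr] : exists2 r : R, 0 < r & forall h, 0 < h < r ->
    forall x, closure Omega x -> `|S h u x - u x| <= e.
  have /cvgrPdist_le/(_ _ e0) := semigroup_continuous hS bu.
  rewrite near_withinE => /nbhs_ballP[r /= r0 Sr]; exists r => //.
  move=> h /andP[h0 hr] x Ox.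
  have := Sr h; rewrite /ball/= sub0r normrN gtr0_norm// => /(_ hr h0).
  rewrite sub0r normrN => hle.
  have bw : bc_space bc Omega (fun x => S h u x - u x).
    rewrite (_ : (fun x => _) = fun x => -1 * u x + S h u x).
      by apply: cl => //; apply: bS; exact: ltW.
    by apply/funext => y; rewrite mulN1r addrC.
  apply: (le_trans (supnorm_ge bO bw Ox)).
  exact: (le_trans (ler_norm _)).
have key s t : 0 <= s -> s <= t -> t - s < r ->
    forall x, closure Omega x -> `|S s u x - S t u x| <= e.
  move=> s0 + tsr x Ox; rewrite le_eqVlt => /predU1P[<-|st].
    by rewrite subrr normr0 ltW.
  have -> : S t u x = S s (S (t - s) u) x.
    rewrite -(semigroupD hS)// ?inE//; first by rewrite addrC subrK.
    by rewrite subr_ge0 ltW.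
  apply: semigroup_dist => //; [|exact: ltW|].
    by apply: bS; rewrite subr_ge0 ltW.
  move=> y Oy; rewrite distrC; apply: Sr => //.
  by rewrite subr_gt0 st.
(* Dividing by c + 1 and not by c, which may be 0, keeps the radius finite. *)
exists (r / (c + 1)); first by rewrite divr_gt0// ltr_wpDl.
move=> s t /andP[s0 _] /andP[t0 _]; rewrite ltr_pdivlMr ?ltr_wpDl// => st x Ox.
have crs : `|s * c - t * c| < r.
  rewrite -mulrBl normrM (ger0_norm c0); apply: le_lt_trans st.
  by rewrite ler_wpM2l// lerDl.
move: crs; rewrite ltr_norml => /andP[h1 h2].
have [le|lt] := leP (s * c) (t * c).
  by apply: key => //; [rewrite mulr_ge0|lra].
by rewrite distrC; apply: key => //; [rewrite mulr_ge0|exact: ltW].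
Qed.

End semigroup.

(** * Conservation of mass by the semigroup *)

Section mass_conservation.
Variables (R : realType) (d : nat) (Omega : set 'rV[R]_d)
  (bc : boundary_condition R d) (S : R -> ('rV[R]_d -> R) -> 'rV[R]_d -> R).
Hypotheses (oO : open Omega) (bO : bounded_set Omega)
  (hS : contraction_semigroup bc Omega S).
Implicit Types u v : 'rV[R]_d -> R.

Let orbit_ucurve1 (T : R) u : bc_space bc Omega u ->
  ucurve (closure Omega) T (S ^~ u).
Proof.
move=> bu; have := orbit_ucurve bO hS T ler01 bu.
by rewrite (_ : (fun s => S (s * 1) u) = S ^~ u)//; apply/funext => s; rewrite mulr1.
Qed.

Let bc_orbit (T : R) u : 0 <= T -> bc_space bc Omega u ->
  bc_space bc Omega (curve_int T (S ^~ u)).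
Proof.
move=> T0 bu; apply: bc_space_curve_int => //; first exact: orbit_ucurve1.
by move=> s /andP[s0 _]; exact: semigroup_space.
Qed.

(** The functional is evaluation of [S h] at x, bounded by contractivity. *)
Lemma semigroup_curve_int t h u x : 0 <= t -> 0 <= h -> bc_space bc Omega u ->
  closure Omega x ->
  S h (curve_int t (S ^~ u)) x =
  \int[lebesgue_measure]_(s in `[0, t]) S (h + s) u x.
Proof.
move=> t0 h0 bu Ox.
rewrite (@functional_curve_int _ _ (closure Omega) (bc_space bc Omega)
  (fun v => S h v x) 1)//.
- apply: eq_Rintegral => s; rewrite inE/= in_itv/= => /andP[s0 _].
  by rewrite -(semigroupD hS)// inE.
- exact: bc_space_lin_closed.
- by move=> a v w bv bw; exact: (semigroup_lin hS).
- by move=> v M bv M0 vM; rewrite mul1r; exact: (semigroup_bound bO hS h0 bv).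
- exact: orbit_ucurve1.
- by move=> s /andP[s0 _]; exact: semigroup_space.
- exact: bc_orbit.
Qed.

(** Since S(h) V = int_h^{t+h} S(s) u ds, the difference quotient of V is
    h^-1 (int_t^{t+h} S(s) u ds - int_0^h S(s) u ds).  By the mean value theorem
    it equals S(c) u - S(c') u at each point, with c in [t, t + h] and c' in
    [0, h], and uniform continuity of the orbit concludes. *)
Lemma generator_curve_int t u : 0 <= t -> bc_space bc Omega u ->
  generator bc Omega S (curve_int t (S ^~ u)) (fun x => S t u x - u x).
Proof.
move=> t0 bu; have [_ cl] := bc_space_lin_closed Omega bc.
split; first exact: bc_orbit.
  rewrite (_ : (fun x => _) = fun x => -1 * u x + S t u x).
    by apply: cl => //; exact: semigroup_space.
  by apply/funext => y; rewrite mulN1r addrC.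
apply/cvgrPdist_le => e e0; have e2 : 0 < e / 2 by rewrite divr_gt0.
have t10 : 0 <= t + 1 by rewrite addr_ge0.
have uS := @orbit_ucurve1 (t + 1) u bu.
have [r r0 Sr] := uS _ e2.
rewrite near_withinE; apply/nbhs_ballP; exists (Num.min r 1).
  by rewrite /= lt_min r0 ltr01.
move=> h; rewrite /ball/= sub0r normrN lt_min => /andP[hr h1] h0.
rewrite (gtr0_norm h0) in hr h1.
rewrite sub0r normrN; apply: norm_supnorm_le; first exact: ltW.
move=> x Ox; rewrite semigroup_curve_int//; last exact: ltW.
pose f s := S s u x.
have uf : ucont (t + 1) f by exact: (ucurve_ucont Ox uS).
have [P dP] := ucont_primitive t10 uf.
have uft : ucont t f.
  move=> c /uf[q q0 qf]; exists q => // a b at_ bt; apply: qf; lra.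
have I1 : \int[lebesgue_measure]_(s in `[0, t]) f s = P t - P 0.
  apply: Rintegral_primitive => //; first exact: ucont_within.
  by move=> s st; apply: dP; lra.
have I2 : \int[lebesgue_measure]_(s in `[0, t]) f (h + s) =
    P (h + t) - P (h + 0).
  apply: (@Rintegral_primitive _ (fun s => f (h + s)) (fun s => P (h + s))) => //.
    apply: ucont_within => c /uf[q q0 qf]; exists q => // a b at_ bt ab.
    apply: qf; [lra|lra|].
    by rewrite (_ : h + a - (h + b) = a - b)//; ring.
  move=> s st; have dPs : is_derive (h + s) 1 P (f (h + s)) by apply: dP; lra.
  have dq : (fun k : R => k^-1 *: (P (h + (k *: (1 : R) + s)) - P (h + s))) =
      (fun k : R => k^-1 *: (P (k *: (1 : R) + (h + s)) - P (h + s))).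
    by apply/funext => k; rewrite addrCA.
  apply: DeriveDef; first by rewrite /derivable dq; case: dPs.
  by rewrite /derive dq; case: dPs.
rewrite /curve_int I1 I2.
have mvt a : 0 <= a <= t -> exists2 c, a <= c <= a + h & P (a + h) - P a = h * f c.
  move=> at_; have ah : a <= a + h by rewrite lerDl ltW.
  have [||c] := @MVT_segment _ P f _ _ ah.
  - by move=> s; rewrite in_itv/= => /andP[? ?]; apply: dP; lra.
  - apply: derivable_within_continuous => s; rewrite in_itv/= => /andP[? ?].
    by have [] : is_derive s 1 P (f s) by apply: dP; lra.
  by rewrite in_itv/= => cah ->; exists c => //; rewrite addrC addKr mulrC.
have [c ct cE] := mvt t ltac:(lra); have [c' c0 cE'] := mvt 0 ltac:(lra).
have -> : h^-1 * (P (h + t) - P (h + 0) - (P t - P 0)) = f c - f c'.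
  apply: (mulfI (lt0r_neq0 h0)); rewrite mulVKf ?lt0r_neq0// mulrBr -cE -cE'.
  by rewrite add0r addr0 (addrC h t); ring.
have -> : u x = f 0 by rewrite /f (semigroup0 hS)// inE.
have h3 : `|f c - f t| <= e / 2.
  by apply: Sr => //; rewrite ?ltr_norml; lra.
have h4 : `|f c' - f 0| <= e / 2.
  by apply: Sr => //; rewrite ?ltr_norml; lra.
move: h3 h4; rewrite -/(f t) !ler_norml => /andP[? ?] /andP[? ?]; lra.
Qed.

(** S(t) u - u is the Laplacian of the integral of the orbit over [0, t]. *)
Lemma semigroup_mass t u : bc_domain bc Omega ->
  laplacian_semigroup bc Omega S -> 0 <= t -> bc_space bc Omega u ->
  integral_over Omega (S t u) = integral_over Omega u.
Proof.
move=> hbc [_ gl] t0 bu.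
have /(integral_laplacian oO bO hbc) := (gl _ _).1 (generator_curve_int t0 bu).
rewrite (_ : (fun x => _) = fun x => -1 * u x + S t u x); last first.
  by apply/funext => y; rewrite mulN1r addrC.
rewrite (integral_over_linear (bc := bc) oO bO)//; first lra.
exact: (semigroup_space hS).
Qed.

End mass_conservation.

(** * The nonlinear term *)

Section reaction.
Variables (R : realType) (d : nat) (Omega : set 'rV[R]_d)
  (bc : boundary_condition R d).
Hypotheses (oO : open Omega) (bO : bounded_set Omega).
Implicit Types u v : 'rV[R]_d -> R.

Lemma continuous_freact : continuous (@freact R).
Proof. by move=> s; apply: cvgB; [exact: cvg_id|exact: exprn_continuous]. Qed.

Lemma continuous_gmob : continuous (@gmob R).
Proof. by move=> s; apply: cvgB; [exact: cvg_cst|exact: exprn_continuous]. Qed.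

Lemma gmob_ge0 (s : R) : `|s| <= 1 -> 0 <= gmob s.
Proof. by move=> s1; rewrite subr_ge0 -real_normK ?num_real// expr_le1. Qed.

(** |f(u)| = |u| g(u) <= g(u) pointwise. *)
Lemma lambda_le1 u : bc_space bc Omega u ->
  (forall x, closure Omega x -> `|u x| <= 1) -> `|lambda Omega u| <= 1.
Proof.
move=> bu u1; have mO := open_measurable_rV oO.
have cf := bc_space_integrable oO bO (bc_space_comp continuous_freact bu).
have cg := bc_space_integrable oO bO (bc_space_comp continuous_gmob bu).
have fg : `|integral_over Omega (@freact R \o u)| <=
    integral_over Omega (@gmob R \o u).
  apply: (le_trans (le_normr_Rintegral mO cf)); apply: le_Rintegral => //.
    exact: integrable_norm.
  move=> x Ox /=; have ux := u1 _ (subset_closure Ox).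
  have -> : freact (u x) = u x * gmob (u x) by rewrite /freact /gmob; ring.
  by rewrite normrM (ger0_norm (gmob_ge0 ux)) ler_piMl// gmob_ge0.
have g0 := le_trans (normr_ge0 _) fg.
rewrite /lambda normrM normfV (ger0_norm g0).
have [->|gn0] := eqVneq (integral_over Omega (@gmob R \o u)) 0.
  by rewrite invr0 mulr0 ler01.
by rewrite ler_pdivrMr ?mul1r// lt_def gn0.
Qed.

(** Factor f(s) - l g(s) = (s - l) (1 - s) (1 + s); then
      kappa - N = (1 - s) (kappa - (s - l) (1 + s)) and
      kappa + N = (1 + s) (kappa + (s - l) (1 - s)),
    where |s - l| <= 2 and 1 + s, 1 - s <= 2. *)
Lemma reaction_bound (kappa l s : R) : 4 <= kappa -> `|l| <= 1 -> `|s| <= 1 ->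
  `|kappa * s + freact s - l * gmob s| <= kappa.
Proof.
move=> k4; rewrite !ler_norml => /andP[l1 l2] /andP[s1 s2].
have k1 : 0 <= (1 - s) * (kappa - (s - l) * (1 + s)).
  apply: mulr_ge0; first by lra.
  have : 0 <= (2 - (s - l)) * (1 + s) by apply: mulr_ge0; lra.
  lra.
have k2 : 0 <= (1 + s) * (kappa + (s - l) * (1 - s)).
  apply: mulr_ge0; first by lra.
  have : 0 <= (2 + (s - l)) * (1 - s) by apply: mulr_ge0; lra.
  lra.
rewrite /freact /gmob; apply/andP; split.
  rewrite -subr_ge0; apply: le_trans k2 _; rewrite le_eqVlt; apply/orP; left.
  by apply/eqP; ring.
rewrite -subr_ge0; apply: le_trans k1 _; rewrite le_eqVlt; apply/orP; left.
by apply/eqP; ring.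
Qed.

Lemma bc_space_nonlin kappa u : bc_space bc Omega u ->
  bc_space bc Omega (nonlin kappa Omega u).
Proof.
move=> bu; rewrite (_ : nonlin _ _ _ =
  (fun s => kappa * s + freact s - lambda Omega u * gmob s) \o u)//.
apply: bc_space_comp bu => s; apply: cvgB.
  by apply: cvgD; [exact: mulrl_continuous|exact: continuous_freact].
by apply: cvgM; [exact: cvg_cst|exact: continuous_gmob].
Qed.

Lemma integral_nonlin kappa u : bc_space bc Omega u ->
  integral_over Omega (@gmob R \o u) != 0 ->
  integral_over Omega (nonlin kappa Omega u) = kappa * integral_over Omega u.
Proof.
move=> bu gn0; have [_ cl] := bc_space_lin_closed Omega bc.
have bf := bc_space_comp continuous_freact bu.
have bg := bc_space_comp continuous_gmob bu.
have -> : nonlin kappa Omega u = fun x => kappa * u x +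
    (fun y => - lambda Omega u * (@gmob R \o u) y + (@freact R \o u) y) x.
  by apply/funext => x; rewrite /nonlin /=; ring.
rewrite (integral_over_linear (bc := bc) oO bO)//; last exact: cl.
rewrite (integral_over_linear (bc := bc) oO bO)//.
by rewrite /lambda mulNr divfK// addNr addr0.
Qed.

(** If the integral vanishes then u^2 = 1 everywhere on Omega, since g(u) is
    continuous and nonnegative and nonempty open sets have positive measure.
    The image of the connected set Omega is an interval that avoids 0, so u is
    constant. *)
Lemma integral_gmob_neq0 u : connected Omega -> bc_space bc Omega u ->
  (forall x, closure Omega x -> `|u x| <= 1) ->
  `|integral_over Omega u| != volume Omega ->
  integral_over Omega (@gmob R \o u) != 0.
Proof.
move=> cO bu u1; apply: contraNN => /eqP g0.
have mO := open_measurable_rV oO.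
have bg := bc_space_comp continuous_gmob bu.
have ig := bc_space_integrable oO bO bg.
have gu0 x : Omega x -> gmob (u x) = 0.
  move=> Ox; apply/eqP; rewrite eq_le gmob_ge0 ?andbT; last first.
    exact/u1/subset_closure.
  rewrite leNgt; apply/negP => gx.
  pose c := gmob (u x) / 2; have c0 : 0 < c by rewrite divr_gt0.
  pose U := Omega `&` [set y | c < gmob (u y)].
  have cgO : {within Omega, continuous (@gmob R \o u)}.
    by apply: continuous_subspaceW bg.1; exact: subset_closure.
  have oU : open U.
    rewrite openE => y [Oy cy]; apply: filterI; first exact: oO.
    move: cgO; rewrite continuous_open_subspace// => /(_ y).
    rewrite inE => /(_ Oy) /(_ [set s | c < s]); apply.
    by apply: open_nbhs_nbhs; split => //; exact: open_gt.
  have mU := open_measurable_rV oU.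
  have Ux : U x by split => //=; rewrite /c; lra.
  have : (0 < \int[lebesgue_rV R d]_(y in Omega) (gmob (u y))%:E)%E.
    apply: (@lt_le_trans _ _ (\int[lebesgue_rV R d]_(y in U) c%:E)%E).
      rewrite integral_cst// mule_gt0 ?lte_fin//.
      by apply: lebesgue_rV_open_gt0 => //; exists x.
    have mg : measurable_fun Omega (fun y => (gmob (u y))%:E).
      by case/integrableP : ig.
    have g_ge0 y : Omega y -> (0 <= (gmob (u y))%:E)%E.
      by move=> Oy; rewrite lee_fin gmob_ge0//; exact/u1/subset_closure.
    apply: (@le_trans _ _ (\int[lebesgue_rV R d]_(y in U) (gmob (u y))%:E)%E).
      apply: ge0_le_integral => //.
      - by move=> y _; rewrite lee_fin ltW.
      - by apply: measurable_funS mg => // y [].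
      - by move=> y [_ /ltW]; rewrite lee_fin.
    by apply: ge0_subset_integral => // y [].
  have := integrable_fin_num mO ig => fin.
  move: g0; rewrite /integral_over /Rintegral => g0.
  by rewrite -(fineK fin) g0 ltxx.
have sq1 x : Omega x -> u x ^+ 2 = 1.
  by move=> /gu0/eqP; rewrite subr_eq0 => /eqP.
have [OE|/set0P[z Oz]] := eqVneq Omega set0.
  by rewrite /volume OE /integral_over Rintegral_set0 measure0 normr0.
have iu : is_interval (u @` Omega).
  apply/connected_intervalP; apply: connected_continuous_connected => //.
  by apply: continuous_subspaceW bu.1; exact: subset_closure.
have n0 : ~ (u @` Omega) 0.
  by move=> [y Oy uy0]; have := sq1 _ Oy; rewrite uy0 expr0n/= => /eqP;
    rewrite eq_sym oner_eq0.
have uz x : Omega x -> u x = u z.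
  move=> Ox; have /eqP := sq1 _ Ox; have /eqP := sq1 _ Oz.
  rewrite !sqrf_eq1 => /orP[]/eqP zE /orP[]/eqP xE; rewrite ?zE ?xE//.
    exfalso; apply: n0; apply: (iu (-1) 1); first by exists x.
      by exists z.
    by rewrite lerN10 ler01.
  exfalso; apply: n0; apply: (iu (-1) 1); first by exists z.
    by exists x.
  by rewrite lerN10 ler01.
have -> : integral_over Omega u = u z * volume Omega.
  rewrite /volume -Rintegral_cst//; apply: eq_Rintegral => x.
  by rewrite inE => /uz.
have vol0 : 0 <= volume Omega by rewrite fine_ge0.
rewrite normrM (ger0_norm vol0).
have /eqP := sq1 _ Oz; rewrite sqrf_eq1 => /orP[]/eqP ->.
  by rewrite normr1 mul1r.
by rewrite normrN normr1 mul1r.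
Qed.

End reaction.

(** * The exponential time differencing step *)

Section etd1.
Variables (R : realType) (d : nat) (Omega : set 'rV[R]_d)
  (bc : boundary_condition R d) (S : R -> ('rV[R]_d -> R) -> 'rV[R]_d -> R)
  (eps kappa tau : R).
Hypotheses (oO : open Omega) (bO : bounded_set Omega)
  (hbc : bc_domain bc Omega) (hL : laplacian_semigroup bc Omega S)
  (kappa4 : 4 <= kappa) (tau0 : 0 < tau).
Let hS : contraction_semigroup bc Omega S := hL.1.
Implicit Types u v : 'rV[R]_d -> R.

Let kappa0 : 0 < kappa. Proof. exact: lt_le_trans kappa4. Qed.
Let tau_ge0 : 0 <= tau. Proof. exact: ltW. Qed.
Let eps0 t : 0 <= t -> 0 <= t * eps ^+ 2.
Proof. by move=> t0; rewrite mulr_ge0// sqr_ge0. Qed.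

Lemma bc_space_exp_L t v : 0 <= t -> bc_space bc Omega v ->
  bc_space bc Omega (exp_L eps kappa S t v).
Proof.
move=> t0 bv; have [b0 cl] := bc_space_lin_closed Omega bc.
rewrite (_ : exp_L _ _ _ _ _ =
  fun x => expR (- kappa * t) * S (t * eps ^+ 2) v x + 0).
  by apply: cl => //; apply: (semigroup_space hS) => //; exact: eps0.
by apply/funext => x; rewrite addr0.
Qed.

Lemma exp_L_bound t v M : 0 <= t -> bc_space bc Omega v -> 0 <= M ->
  (forall x, closure Omega x -> `|v x| <= M) ->
  forall x, closure Omega x ->
    `|exp_L eps kappa S t v x| <= expR (- kappa * t) * M.
Proof.
move=> t0 bv M0 vM x Ox.
rewrite /exp_L normrM (ger0_norm (expR_ge0 _)) ler_wpM2l ?expR_ge0//.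
by apply: (semigroup_bound bO hS) => //; exact: eps0.
Qed.

Lemma integral_exp_L t v : 0 <= t -> bc_space bc Omega v ->
  integral_over Omega (exp_L eps kappa S t v) =
  expR (- kappa * t) * integral_over Omega v.
Proof.
move=> t0 bv; have bSv := semigroup_space hS (eps0 t0) bv.
rewrite /integral_over RintegralZl//.
- by congr (_ * _); apply: (semigroup_mass oO bO hS hbc) => //; exact: eps0.
- exact: open_measurable_rV.
- exact: (bc_space_integrable oO bO bSv).
Qed.

Lemma expR_decay_lipschitz s t : 0 <= s -> 0 <= t ->
  `|expR (- kappa * s) - expR (- kappa * t)| <= kappa * `|s - t|.
Proof.
wlog st : s t / s <= t.
  move=> H s0 t0; have [st|/ltW ts] := leP s t; first exact: H.
  by rewrite distrC (distrC s); exact: H.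
move=> s0 t0; rewrite ger0_norm; last first.
  by rewrite subr_ge0 ler_expR !mulNr lerN2 ler_wpM2l// ltW.
rewrite distrC ger0_norm ?subr_ge0//.
have e1 : expR (- kappa * s) <= 1.
  by rewrite expR_le1 mulNr oppr_le0 mulr_ge0// ltW.
have e2 : expR (- kappa * t) = expR (- kappa * s) * expR (- (kappa * (t - s))).
  by rewrite -expRD; congr expR; ring.
have e3 := expR_ge1Dx (- (kappa * (t - s))).
have k0 : 0 <= kappa * (t - s) by rewrite mulr_ge0 ?subr_ge0// ltW.
rewrite e2 -[X in X - _]mulr1 -mulrBr.
apply: (@le_trans _ _ (expR (- kappa * s) * (kappa * (t - s)))).
  by rewrite ler_wpM2l ?expR_ge0//; lra.
by rewrite ler_piMl.
Qed.

Lemma ucurve_exp_L v : bc_space bc Omega v ->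
  ucurve (closure Omega) tau (fun s => exp_L eps kappa S (tau - s) v).
Proof.
move=> bv e e0; have [M M0 vM] := within_closure_bounded bO bv.1.
have e2 : 0 < e / 2 by rewrite divr_gt0.
have [r r0 Sr] := orbit_ucurve bO hS tau (sqr_ge0 eps) bv e2.
have kM : 0 < 2 * (kappa * M + 1) by rewrite mulr_gt0// ltr_wpDl// mulr_ge0// ltW.
exists (Num.min r (e / (2 * (kappa * M + 1)))).
  by rewrite lt_min r0 divr_gt0.
move=> s t sT tT; rewrite lt_min ltr_pdivlMr// => /andP[st1 st2] x Ox.
have st : `|tau - s - (tau - t)| = `|s - t|.
  by rewrite distrC; congr (`| _ |); ring.
rewrite /exp_L; set a := expR _; set b := expR _.
set p := S _ _ _; set q := S _ _ _.
have pq : `|p - q| <= e / 2 by apply: Sr => //; rewrite ?st//; lra.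
have ab : `|a - b| <= kappa * `|s - t|.
  by rewrite -st; apply: expR_decay_lipschitz; lra.
have a1 : `|a| <= 1.
  rewrite ger0_norm ?expR_ge0// expR_le1 mulNr oppr_le0 mulr_ge0 ?(ltW kappa0)//; lra.
have qM : `|q| <= M.
  by apply: (semigroup_bound bO hS) => //; apply: eps0; lra.
have -> : a * p - b * q = a * (p - q) + (a - b) * q by ring.
apply: (le_trans (ler_normD _ _)); rewrite !normrM.
have h1 : `|a| * `|p - q| <= 1 * (e / 2) by exact: ler_pM.
have h2 : `|a - b| * `|q| <= kappa * `|s - t| * M by exact: ler_pM.
have := normr_ge0 (s - t); lra.
Qed.

Lemma etd1_stepE u x : etd1_step eps kappa tau Omega S u x =
  exp_L eps kappa S tau u x + curve_int tau
    (fun s => exp_L eps kappa S (tau - s) (nonlin kappa Omega u)) x.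
Proof. by []. Qed.

Lemma continuous_decay : continuous (fun s : R => expR (- kappa * (tau - s))).
Proof.
move=> s; apply: continuous_comp; last exact: continuous_expR.
by apply: cvgM; [exact: cvg_cst|apply: cvgB; [exact: cvg_cst|exact: cvg_id]].
Qed.

Lemma integral_decay : \int[lebesgue_measure]_(s in `[0, tau])
  (expR (- kappa * (tau - s)) * kappa) = 1 - expR (- kappa * tau).
Proof.
have dE (s : R) : is_derive s (1 : R)
    (fun r : R => expR (- kappa * (tau - r)))
    (expR (- kappa * (tau - s)) * kappa).
  apply: is_derive_eq; rewrite /GRing.scale/=; ring.
have cE : {within `[0, tau],
    continuous (fun s : R => expR (- kappa * (tau - s)) * kappa)}.
  apply: continuous_subspaceT => s; apply: cvgM; last exact: cvg_cst.
  exact: continuous_decay.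
have := Rintegral_primitive tau_ge0 cE (fun s _ => dE s).
by move->; rewrite subrr mulr0 expR0 subr0.
Qed.

(** The step is an average of S(eps^2 tau) u and of the functions
    S(eps^2 (tau - s)) N[u] / kappa, all bounded by 1, with weights
    exp(- kappa tau) and kappa exp(- kappa (tau - s)) ds of total mass 1. *)
Lemma etd1_step_bound u : bc_space bc Omega u ->
  (forall x, closure Omega x -> `|u x| <= 1) ->
  forall x, closure Omega x -> `|etd1_step eps kappa tau Omega S u x| <= 1.
Proof.
move=> bu u1 x Ox; rewrite etd1_stepE.
set N := nonlin kappa Omega u.
have bN : bc_space bc Omega N by exact: bc_space_nonlin.
have NK y : closure Omega y -> `|N y| <= kappa.
  move=> Oy; apply: reaction_bound; first exact: kappa4.
    exact: (lambda_le1 oO bO bu u1).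
  exact: u1.
have h1 := exp_L_bound tau_ge0 bu ler01 u1 Ox.
rewrite mulr1 in h1.
have uF := ucurve_ucont Ox (ucurve_exp_L bN).
have cF := ucont_within uF.
have iF := continuous_compact_integrable (@segment_compact _ 0 tau) cF.
have h2 : `|curve_int tau (fun s => exp_L eps kappa S (tau - s) N) x| <=
    1 - expR (- kappa * tau).
  rewrite -integral_decay; apply: (le_trans (le_normr_Rintegral _ iF)) => //.
  apply: le_Rintegral => //.
  - exact: integrable_norm.
  - apply: continuous_compact_integrable; first exact: segment_compact.
    apply: continuous_subspaceT => s; apply: cvgM; last exact: cvg_cst.
    exact: continuous_decay.
  - move=> s; rewrite /= in_itv/= => /andP[s0 sT].
    by apply: exp_L_bound => //; [rewrite subr_ge0|exact: ltW].
by apply: (le_trans (ler_normD _ _)); lra.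
Qed.

Lemma integral_etd1_step u : bc_space bc Omega u ->
  integral_over Omega (@gmob R \o u) != 0 ->
  integral_over Omega (etd1_step eps kappa tau Omega S u) =
  integral_over Omega u.
Proof.
move=> bu gn0; set N := nonlin kappa Omega u.
have bN : bc_space bc Omega N by exact: bc_space_nonlin.
pose F s := exp_L eps kappa S (tau - s) N.
have bF s : 0 <= s <= tau -> bc_space bc Omega (F s).
  by move=> /andP[_ sT]; apply: bc_space_exp_L => //; rewrite subr_ge0.
have uF : ucurve (closure Omega) tau F by exact: ucurve_exp_L.
have bI := bc_space_curve_int tau_ge0 uF bF.
have vol0 : 0 <= volume Omega by rewrite fine_ge0.
have -> : etd1_step eps kappa tau Omega S u =
    fun x => 1 * exp_L eps kappa S tau u x + curve_int tau F x.
  by apply/funext => x; rewrite mul1r.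
rewrite (integral_over_linear (bc := bc) oO bO)//; last exact: bc_space_exp_L.
rewrite mul1r integral_exp_L//.
rewrite (@functional_curve_int _ _ (closure Omega) (bc_space bc Omega)
  (integral_over Omega) (volume Omega))//; last 3 first.
- exact: bc_space_lin_closed.
- by move=> a v w bv bw; exact: (integral_over_linear oO bO a bv bw).
- by move=> v M bv M0 vM; exact: (integral_over_bound oO bO bv).
under eq_Rintegral => s.
  rewrite inE/= in_itv/= => /andP[_ sT].
  rewrite integral_exp_L ?subr_ge0// /N (integral_nonlin oO bO _ bu)// mulrA.
  over.
rewrite RintegralZr//.
  by rewrite integral_decay; ring.
apply: continuous_compact_integrable; first exact: segment_compact.
apply: continuous_subspaceT => s; apply: cvgM; last exact: cvg_cst.
exact: continuous_decay.
Qed.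

End etd1.

Theorem proposition1 (R : realType) (d : nat) (hd : d = 2%N \/ d = 3%N)
    (Omega : set 'rV[R]_d) (bc : boundary_condition R d)
    (eps kappa tau : R)
    (S : R -> ('rV[R]_d -> R) -> 'rV[R]_d -> R)
    (u0 : 'rV[R]_d -> R) (u : nat -> 'rV[R]_d -> R)
    (hOmega : lipschitz_domain Omega) (hbc : bc_domain bc Omega)
    (heps : 0 < eps) (hS : laplacian_semigroup bc Omega S)
    (hu0 : bc_space bc Omega u0) (hu0_le1 : supnorm Omega u0 <= 1)
    (hM0 : `|integral_over Omega u0| != volume Omega)
    (hkappa : kappa_min R <= kappa) (htau : 0 < tau)
    (hu : etd1_solution bc eps kappa tau Omega S u0 u) :
  forall n : nat,
    integral_over Omega (@gmob R \o u n) != 0 /\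
    integral_over Omega (u n) = integral_over Omega u0.
Proof.
have [oO cO bO _] := hOmega; have [bu uE0 uES] := hu.
rewrite kappa_minE in hkappa.
suff inv n : (forall x, closure Omega x -> `|u n x| <= 1) /\
    integral_over Omega (u n) = integral_over Omega u0.
  move=> n; have [un1 unM] := inv n; split=> //.
  by apply: integral_gmob_neq0 => //; rewrite unM.
elim: n => [|n [un1 unM]].
  split; last exact: eq_integral_over.
  move=> x Ox; rewrite uE0 ?inE//; apply: le_trans hu0_le1.
  exact: (supnorm_ge bO hu0).
split=> [x Ox|].
  rewrite uES ?inE//.
  exact: (etd1_step_bound eps oO bO hS hkappa htau (bu n) un1 Ox).
rewrite (eq_integral_over (uES n)) -unM.
apply: (integral_etd1_step eps oO bO hbc hS hkappa htau (bu n)).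
by apply: (integral_gmob_neq0 oO bO cO (bu n) un1); rewrite unM.
Qed.
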